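(* Let $k\geq 2$ and $\tau=k(k-1)\cdots 1\in S_k$, and consider $S_n(\tau)$ with the uniform probability measure $\mathbb{P}^\tau_n$. Then whenever $0<\epsilon<k-2$, $$\lim_{n\to\infty}\mathbb{P}^\tau_n\Big(\mathrm{LIS}_n>\tfrac{1+\epsilon}{k-1}n\Big)^{1/n}=\Big[(1+\epsilon)^{1+\epsilon}\Big(1-\tfrac{\epsilon}{k-2}\Big)^{k-2-\epsilon}\Big]^{-\frac{2}{k-1}},$$ and $\mathbb{P}^\tau_n\big(\mathrm{LIS}_n<\tfrac{n}{k-1}\big)=0$ for every $n$. Consequently $\mathrm{LIS}_n/n\to 1/(k-1)$ in probability as $n\to\infty$.
   Context: $S_n(\tau)$ is the set of permutations of $[n]$ avoiding the pattern $\tau$; $\mathrm{LIS}_n(\sigma)$ is the length of the longest increasing subsequence of $\sigma$. *)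

(* Defs.v *)
From HB Require Import structures.
From mathcomp Require Export all_boot all_order all_fingroup all_algebra.
From mathcomp Require Export all_classical all_reals all_analysis.

Set Implicit Arguments.
Unset Strict Implicit.
Unset Printing Implicit Defensive.

Export Order.TTheory GRing.Theory Num.Theory.
Export numFieldNormedType.Exports.

Local Open Scope ring_scope.

(* Permutations of [n] are 'S_n, so positions and values are shifted from
   {1, ..., n} to {0, ..., n-1}. *)

Definition contains_pattern (n k : nat) (s : 'S_n) (t : 'S_k) : bool :=
  [exists f : {ffun 'I_k -> 'I_n},
     [forall i : 'I_k, forall j : 'I_k, (i < j)%N ==> (f i < f j)%N] &&
     [forall i : 'I_k, forall j : 'I_k, (s (f i) < s (f j))%N == (t i < t j)%N]].

Definition avoiders (n k : nat) (t : 'S_k) : {set 'S_n} :=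
  [set s : 'S_n | ~~ contains_pattern s t].

Definition decreasing_perm (k : nat) : 'S_k := perm (@rev_ord_inj k).

(* A subsequence of s is encoded by its set of positions. *)
Definition increasing_on (n : nat) (s : 'S_n) (A : {set 'I_n}) : bool :=
  [forall i in A, forall j in A, (i < j)%N ==> (s i < s j)%N].

Definition LIS (n : nat) (s : 'S_n) : nat :=
  \max_(A : {set 'I_n} | increasing_on s A) #|A|.

Definition uniform_prob (R : realType) (T : finType) (S : {set T})
    (E : pred T) : R :=
  #|[set x in S | E x]|%:R / #|S|%:R.

Definition avoid_prob (R : realType) (k : nat) (t : 'S_k) (n : nat)
    (E : pred 'S_n) : R :=
  uniform_prob R (avoiders n t) E.
Arguments avoid_prob R {k} t n E.

(* X_n -> l in probability under the uniform measures on S_n(t). *)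
Definition cvg_in_avoid_prob (R : realType) (k : nat) (t : 'S_k)
    (X : forall n : nat, 'S_n -> R) (l : R) : Prop :=
  forall delta : R, 0 < delta ->
    (avoid_prob R t n (fun s => delta < `|X n s - l|) @[n --> \oo] --> (0 : R))%classic.

(* Main.v *)
(* Put d = k - 1 and count with words over d letters. The number of permutations
   avoiding k...1 with LIS > c n turns out to be exp (2 n H) up to subexponential factors,
   with H the entropy of (c, (1-c)/(d-1), ..., (1-c)/(d-1)); c = 1/d gives d^(2 n) for the
   number of all avoiders, and the ratio is the stated rate.

   Upper bound. Row insertion into a single row, the first row of the
   Robinson-Schensted correspondence, leaves a row at least as long as any increasing
   subsequence, and the bumped values form a partial permutation whose longest decreasing
   subsequence is shorter by one. Iterating d times thus encodes an avoider injectively by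
   two words, telling how often each position bumps and how often each value is bumped,
   in which the letter 0 occurs at least LIS times. A Chernoff bound counts such words.

   Lower bound. Matching the occurrences of each letter in order, two words with the same
   content give a union of d increasing sequences. The words are recovered from the
   permutation if every letter i + 1 is preceded by a larger value of letter i while
   inversions always increase the letter. Words made of consecutive blocks of fixed
   content, where letter i is delayed by i blocks in positions and advanced by i blocks in
   values, have this property, and a multinomial coefficient counts such blocks. *)

Require Import Defs.
From mathcomp Require Import zify ring lra.

Set Implicit Arguments.
Unset Strict Implicit.
Unset Printing Implicit Defensive.

(* Gives finite sets priority over the classical sets of the same names. *)
Import mathcomp.boot.fintype mathcomp.boot.finset.

(** * Row insertion *)

Section RowInsertion.
Variable m : nat.
Implicit Types (row : {set 'I_m}) (x y z : 'I_m) (f : nat -> option 'I_m) (t : nat).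

Definition bump_val row x : option 'I_m :=
  [pick y in row | x < y & [forall z in row, (x < z) ==> (y <= z)]].

Variant bump_val_spec row x : option 'I_m -> Prop :=
| BumpSome y of y \in row & x < y &
    (forall z, z \in row -> x < z -> y <= z) : bump_val_spec row x (Some y)
| BumpNone of (forall z, z \in row -> z <= x) : bump_val_spec row x None.

Lemma bump_valP row x : bump_val_spec row x (bump_val row x).
Proof.
rewrite /bump_val; case: pickP => [y /and3P[yr xy /forall_inP ymin]|nobump].
  by apply: BumpSome => // z zr; apply/implyP/ymin.
apply: BumpNone => z zr; rewrite leqNgt; apply/negP => xz.
have zP : (z \in row) && (x < z) by rewrite zr.
case: (@arg_minnP _ z (fun y => (y \in row) && (x < y)) (@nat_of_ord m) zP)
  => y /andP[yr xy] ymin.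
have /negP := nobump y; apply; rewrite /= yr xy /=.
by apply/forall_inP => w wr; apply/implyP => xw; apply: ymin; rewrite wr.
Qed.

Definition oset1 (o : option 'I_m) : {set 'I_m} := if o is Some x then [set x] else set0.

Definition insert row x : {set 'I_m} := x |: row :\: oset1 (bump_val row x).

Lemma insert_sub row x : insert row x \subset x |: row.
Proof. exact/setUS/subsetDl. Qed.

Lemma insertK row x : x \notin row ->
  insert row x :\ x :|: oset1 (bump_val row x) = row.
Proof.
move=> x_new; apply/setP => z; rewrite /insert.
case: bump_valP => [y yr xy _|_]; rewrite !inE ?orbF.
  case: (eqVneq z y) => [->|_]; first by rewrite orbT.
  by rewrite orbF /=; case: eqVneq => // ->; rewrite (negPf x_new).
by case: eqVneq => // ->; rewrite (negPf x_new).
Qed.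

Lemma bump_insert_inj row row' x x' : bump_val row x = bump_val row' x' ->
  insert row x = insert row' x' -> x = x'.
Proof.
suff inserted_le r r' z z' : bump_val r z = bump_val r' z' -> insert r z = insert r' z' ->
    z' <= z.
  move=> bumpE insertE; apply/val_inj/anti_leq.
  by rewrite (inserted_le row' row) ?(inserted_le row row').
move=> bumpE insertE; rewrite leqNgt; apply/negP => zz'.
have : z' \in insert r z by rewrite insertE setU11.
rewrite /insert in_setU1; case: eqP => [zE|_ /=]; first by rewrite zE ltnn in zz'.
rewrite in_setD => /andP[_ z'r]; case: bump_valP bumpE => [y _ _ ymin|zmax].
  case: bump_valP => // y' _ z'y' _ [yE].
  by have := ymin z' z'r zz'; rewrite yE leqNgt z'y'.
by move=> _; have := zmax z' z'r; rewrite leqNgt zz'.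
Qed.

Lemma insert_inj row row' x x' : x \notin row -> x' \notin row' ->
  bump_val row x = bump_val row' x' -> insert row x = insert row' x' ->
  x = x' /\ row = row'.
Proof.
move=> x_new x'_new bumpE insertE; have xE := bump_insert_inj bumpE insertE; split=> //.
by rewrite -(insertK x_new) insertE bumpE xE insertK.
Qed.

Lemma card_insert_below row x v : x \notin row ->
  #|[set z in row | z < v]| <= #|[set z in insert row x | z < v]|.
Proof.
move=> x_new; rewrite /insert; case: bump_valP => [y yr xy _|_].
  case: (ltnP y v) => yv.
    rewrite (cardsD1 y) (cardsD1 x [set z in _ | _]) !inE yr yv eqxx (ltn_trans xy yv) /=.
    apply/subset_leq_card/subsetP => z; rewrite !inE => /and3P[-> zr ->].
    by rewrite zr orbT !andbT; apply: contraNneq x_new => <-.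
  apply/subset_leq_card/subsetP => z; rewrite !inE => /andP[-> zv]; rewrite zv !andbT.
  by apply/orP; right; apply: contraTneq zv => ->; rewrite -leqNgt.
by apply/subset_leq_card/subsetP => z; rewrite !inE => /andP[-> ->]; rewrite orbT.
Qed.

Lemma card_insert_below_lt row x v : x < v ->
  #|[set z in row | z < x]| < #|[set z in insert row x | z < v]|.
Proof.
move=> xv; rewrite [ltnRHS](cardsD1 x) !inE eqxx xv /= ltnS.
apply/subset_leq_card/subsetP => z; rewrite !inE => /andP[zr zx].
rewrite (ltn_trans zx xv) andbT -val_eqE (ltn_eqF zx) /=.
case: bump_valP => [y _ xy _|_]; rewrite ?inE zr ?andbT //.
by apply: contraTneq (ltn_trans zx xy) => ->; rewrite ltnn.
Qed.

Fixpoint first_row f t : {set 'I_m} :=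
  if t is t'.+1 then
    if f t' is Some x then insert (first_row f t') x else first_row f t'
  else set0.

Definition bumped f t : option 'I_m := obind (bump_val (first_row f t)) (f t).

Definition stream_inj f := forall t t' x, f t = Some x -> f t' = Some x -> t = t'.

Definition stream_ran f t : {set 'I_m} := [set x | [exists i : 'I_t, f i == Some x]].

Lemma stream_ranP f t x :
  reflect (exists2 i, i < t & f i = Some x) (x \in stream_ran f t).
Proof.
rewrite inE; apply: (iffP existsP) => [[i /eqP fi]|[i it fi]]; first by exists i.
by exists (Ordinal it); apply/eqP.
Qed.

Lemma stream_ran0 f : stream_ran f 0 = set0.
Proof. by apply/setP => x; rewrite in_set0; apply/negbTE/stream_ranP => -[]. Qed.

Lemma stream_ranS f t :
  stream_ran f t.+1 = oset1 (f t) :|: stream_ran f t.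
Proof.
apply/setP => y; rewrite in_setU; apply/stream_ranP/orP => [[i]|].
  rewrite ltnS leq_eqVlt => /predU1P[->->|it fi]; first by rewrite set11; left.
  by right; apply/stream_ranP; exists i.
case=> [|/stream_ranP[i it fi]]; last by exists i => //; apply: ltnW.
by case ft: (f t) => [x|]; rewrite inE // => /eqP->; exists t.
Qed.

Lemma leq_stream_ran f t t' : t <= t' -> stream_ran f t \subset stream_ran f t'.
Proof.
move=> tt'; apply/subsetP => x /stream_ranP[i it fi].
by apply/stream_ranP; exists i => //; apply: leq_trans tt'.
Qed.

Lemma stream_ran_fresh f t x : stream_inj f -> f t = Some x -> x \notin stream_ran f t.
Proof.
by move=> f_inj ft; apply/stream_ranP => -[i it fi]; rewrite (f_inj _ _ _ fi ft) ltnn in it.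
Qed.

Lemma card_stream_dom f t : stream_inj f ->
  #|[set i : 'I_t | isSome (f i)]| = #|stream_ran f t|.
Proof.
move=> f_inj; rewrite -[RHS](@card_imset _ _ Some) => [|x y []//].
rewrite -(@card_in_imset _ _ (fun i : 'I_t => f i)) => [|i j]; last first.
  rewrite !inE; case fi: (f i) => [x|//] _ _ /esym fj; exact/val_inj/f_inj/fj.
apply: eq_card => o; apply/imsetP/imsetP => [[i +]|[x /stream_ranP[i it fi]]] ->.
  by rewrite inE; case fi: (f i) => [x|//] _; exists x => //; apply/stream_ranP; exists i.
by exists (Ordinal it); rewrite ?inE /= fi.
Qed.

Lemma first_row_sub f t : first_row f t \subset stream_ran f t.
Proof.
elim: t => [|t IH]; first exact: sub0set.
rewrite stream_ranS /=; case: (f t) => [x|]; last by rewrite set0U.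
by apply: subset_trans (insert_sub _ _) _; apply: setUS.
Qed.

Lemma bumpedP f t y : bumped f t = Some y ->
  y \in first_row f t /\ exists x, [/\ f t = Some x, x < y &
    forall z, z \in first_row f t -> x < z -> y <= z].
Proof.
rewrite /bumped; case ft: (f t) => [x|//] /=.
by case: bump_valP => // w wr xw wmin [<-]; split=> //; exists x.
Qed.

Lemma stream_ran_bumped_sub f t : stream_ran (bumped f) t \subset stream_ran f t.
Proof.
apply/subsetP => y /stream_ranP[i it /bumpedP[+ _]].
by move/(subsetP (first_row_sub _ _)); apply: subsetP; apply: leq_stream_ran (ltnW it).
Qed.

Lemma first_row_ran f t : stream_inj f ->
  first_row f t = stream_ran f t :\: stream_ran (bumped f) t.
Proof.
move=> f_inj; elim: t => [|t IH]; first by rewrite !stream_ran0 setD0.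
rewrite !stream_ranS /= /bumped; case ft: (f t) => [x|] /=; last by rewrite !set0U.
have x_unbumped : x \notin stream_ran (bumped f) t.
  by apply: contra (stream_ran_fresh f_inj ft); apply/subsetP/stream_ran_bumped_sub.
apply/setP => z; rewrite /insert !(in_setU, in_setD, in_set1) IH in_setD.
case: (eqVneq z x) => [->|_]; rewrite /= ?(negPf x_unbumped) ?orbF; last first.
  by rewrite negb_or andbA.
by case: bump_valP => [y _ xy _|_]; rewrite !inE // -val_eqE /= (ltn_eqF xy).
Qed.

Lemma bumped_inj f : stream_inj f -> stream_inj (bumped f).
Proof.
move=> f_inj.
have time_le t t' y : bumped f t = Some y -> bumped f t' = Some y -> t' <= t.
  move=> bt /bumpedP[+ _]; rewrite first_row_ran // inE leqNgt => /andP[+ _].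
  by apply: contra => tt'; apply/stream_ranP; exists t.
by move=> t t' y bt bt'; apply: anti_leq; rewrite (time_le t' t y) ?(time_le t t' y).
Qed.

Lemma iter_bumped_inj f j : stream_inj f -> stream_inj (iter j bumped f).
Proof. by move=> f_inj; elim: j => // j IH; apply: bumped_inj. Qed.

(* Reverse insertion: the last entry and the previous row are determined by the
   last row and the last bumped value. *)
Lemma stream_recover f f' n : stream_inj f -> stream_inj f' ->
  {in gtn n, forall t, isSome (f t) = isSome (f' t)} ->
  {in gtn n, bumped f =1 bumped f'} -> stream_ran f n = stream_ran f' n ->
  {in gtn n, f =1 f'}.
Proof.
move=> f_inj f'_inj domE bumpE ranE.
have : first_row f n = first_row f' n.
  rewrite !first_row_ran // ranE; congr (_ :\: _); apply/setP => y.
  apply/stream_ranP/stream_ranP => -[i it]; first by rewrite bumpE //; exists i.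
  by rewrite -bumpE //; exists i.
elim: n {ranE} domE bumpE => // n IH domE bumpE rowE.
have fresh g x : stream_inj g -> g n = Some x -> x \notin first_row g n.
  move=> g_inj gn; apply: contra (stream_ran_fresh g_inj gn).
  exact/subsetP/first_row_sub.
have [fnE prev_rowE] : f n = f' n /\ first_row f n = first_row f' n.
  have := domE n (ltnSn n); have := bumpE n (ltnSn n); move: rowE; rewrite /= /bumped.
  have := fresh f; have := fresh f'.
  case: (f n) (f' n) => [x|] [x'|] //= f'_fresh f_fresh insertE bump_valE _.
  have [x_new x'_new] := (f_fresh x f_inj erefl, f'_fresh x' f'_inj erefl).
  by have [-> ->] := insert_inj x_new x'_new bump_valE insertE.
move=> t; rewrite inE ltnS leq_eqVlt => /predU1P[-> //|tn].
by apply: IH => // i it; [apply: domE | apply: bumpE]; apply: ltnW.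
Qed.

(* A decreasing subsequence with l + 1 terms, ending with the value x at time t. *)
Fixpoint dec_chain f l t x : bool :=
  (f t == Some x) &&
  (if l is l'.+1 then
     [exists i : 'I_t, [exists y : 'I_m, (x < y) && dec_chain f l' i y]]
   else true).

Lemma dec_chainSP f l t x :
  reflect (f t = Some x /\ exists i y, [/\ i < t, x < y & dec_chain f l i y])
    (dec_chain f l.+1 t x).
Proof.
apply: (iffP andP) => -[/eqP ft].
  by case/existsP => i /existsP[y /andP[xy c]]; split=> //; exists i, y.
case=> i [y [it xy c]]; split=> //.
by apply/existsP; exists (Ordinal it); apply/existsP; exists y; rewrite xy.
Qed.

Lemma dec_chain_val f l t x : dec_chain f l t x -> f t = Some x.
Proof. by case: l => [|l] /andP[/eqP]. Qed.

(* Append either the last bumped value itself, if it was inserted after the previous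
   bump, or else the value causing that bump. *)
Lemma dec_chain_bumped_lift f l t y : stream_inj f -> dec_chain (bumped f) l t y ->
  exists i x, [/\ i < t, y <= x & dec_chain f l i x].
Proof.
move=> f_inj; elim: l t y => [|l IH] t y /[dup] /dec_chain_val/bumpedP[yr _].
  move=> _; have /stream_ranP[i it fi] := subsetP (first_row_sub f t) y yr.
  by exists i, y; split; rewrite //= fi eqxx.
case/dec_chainSP=> _ [i' [y' [i't yy' chain']]].
have [_ [x [fi' xy' xmin]]] := bumpedP (dec_chain_val chain').
have [i [z [ii' y'z chain]]] := IH _ _ chain'.
move: yr; rewrite first_row_ran // in_setD => /andP[ybumped /stream_ranP[j jt fj]].
case: (ltnP i' j) => i'j.
  exists j, y; split=> //; apply/dec_chainSP; split=> //; exists i, z; split=> //.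
  - exact: ltn_trans i'j.
  - exact: leq_trans y'z.
exists i', x; split=> //; last first.
  by apply/dec_chainSP; split=> //; exists i, z; rewrite ii' (leq_trans xy').
rewrite leqNgt; apply/negP => xy; move: i'j; rewrite leq_eqVlt => /predU1P[ji'|ji'].
  by move: fj; rewrite ji' fi' => -[xE]; rewrite xE ltnn in xy.
suff /xmin/(_ xy) : y \in first_row f i' by rewrite leqNgt yy'.
rewrite first_row_ran // in_setD; apply/andP; split; last by apply/stream_ranP; exists j.
by apply: contra ybumped; apply/subsetP/leq_stream_ran/ltnW.
Qed.

Lemma dec_chain_bumped f l t y : stream_inj f -> dec_chain (bumped f) l t y ->
  exists x, dec_chain f l.+1 t x.
Proof.
move=> f_inj /[dup] /dec_chain_val/bumpedP[_ [x [ft xy _]]].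
case/(dec_chain_bumped_lift f_inj) => i [z [it yz c]].
by exists x; apply/dec_chainSP; split=> //; exists i, z; rewrite it (leq_trans xy).
Qed.

Lemma dec_chain_iter_bumped f j l t y : stream_inj f ->
  dec_chain (iter j bumped f) l t y -> exists x, dec_chain f (j + l) t x.
Proof.
move=> f_inj; elim: j l y => [|j IH] l y; first by exists y.
case/(dec_chain_bumped (@iter_bumped_inj f j f_inj)) => x /IH.
by rewrite addSnnS.
Qed.

End RowInsertion.

(** * Avoiders and colorings by increasing sequences *)

Section Permutations.
Variable n : nat.
Implicit Types (s : 'S_n) (i j : 'I_n) (A : {set 'I_n}).

Lemma perm_ltnNlt s i j : i < j -> (s i < s j) = ~~ (s j < s i).
Proof.
move=> ij; rewrite -leqNgt ltn_neqAle (inj_eq val_inj) (inj_eq perm_inj).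
by rewrite -val_eqE (ltn_eqF ij).
Qed.

Lemma LIS_witness s : exists2 A, increasing_on s A & #|A| = LIS s.
Proof.
have increasing0 : increasing_on s set0 by apply/forall_inP => i; rewrite inE.
have [|A incA AE] := @eq_bigmax_cond _ (increasing_on s) (fun A => #|A|).
  by apply/card_gt0P; exists set0.
by exists A.
Qed.

Lemma increasing_LIS s A : increasing_on s A -> #|A| <= LIS s.
Proof. by move=> incA; apply: (leq_bigmax_cond (F := fun A : {set 'I_n} => #|A|)). Qed.

Lemma LIS_le s : LIS s <= n.
Proof. by apply/bigmax_leqP => A _; rewrite -[leqRHS]card_ord max_card. Qed.

Lemma decreasing_path_contains s i p :
  path (fun i j => (j < i) && (s i < s j)) i p ->
  contains_pattern s (decreasing_perm (size p).+1).
Proof.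
set R := (fun i j : 'I_n => _) => ip.
have R_trans : transitive R.
  by move=> y x z /andP[yx xy] /andP[zy yz]; rewrite /R (ltn_trans zy) ?(ltn_trans xy).
pose f a := nth i (i :: p) a.
have Rf (a b : 'I_(size p).+1) : a < b -> (f b < f a) && (s (f a) < s (f b)).
  by move=> ab; apply: (sorted_ltn_nth R_trans i) => //; apply: ltn_ord.
have rev_lt (a b : 'I_(size p).+1) : a < b -> rev_ord b < rev_ord a.
  by rewrite /= => ab; apply: ltn_sub2l => //; apply: leq_trans (ltn_ord b).
apply/existsP; exists [ffun a : 'I_(size p).+1 => f (rev_ord a)]; apply/andP; split.
  apply/forallP => a; apply/forallP => b; apply/implyP => ab; rewrite !ffunE.
  by have /andP[] := Rf _ _ (rev_lt _ _ ab).
apply/forallP => a; apply/forallP => b; rewrite !ffunE !permE.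
case: (ltngtP (rev_ord a) (rev_ord b)) => [/Rf/andP[_ ->]//|/Rf/andP[_ sba]|/val_inj->].
  by rewrite ltnNge ltnW.
by rewrite ltnn.
Qed.

Definition perm_stream s (t : nat) : option 'I_n := omap s (insub t).

Lemma perm_streamE s i : perm_stream s i = Some (s i).
Proof. by rewrite /perm_stream valK. Qed.

Lemma perm_streamP s t x : perm_stream s t = Some x ->
  exists2 i : 'I_n, t = i & x = s i.
Proof. by rewrite /perm_stream; case: insubP => // i _ <- [<-]; exists i. Qed.

Lemma perm_stream_inj s : stream_inj (perm_stream s).
Proof. by move=> t t' x /perm_streamP[i -> ->] /perm_streamP[i' -> /perm_inj->]. Qed.

Lemma dec_chain_path s l t x : dec_chain (perm_stream s) l t x -> exists i p,
  [/\ t = i, x = s i, size p = l & path (fun i j => (j < i) && (s i < s j)) i p].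
Proof.
elim: l t x => [|l IH] t x.
  by rewrite /= andbT => /eqP/perm_streamP[i -> ->]; exists i, [::].
case/dec_chainSP=> /perm_streamP[i -> ->] [t' [y [t'i siy /IH[j [p [t'j yj <- jp]]]]]].
by exists i, (j :: p); split; rewrite //= jp -t'j t'i -yj siy.
Qed.

Lemma dec_chain_contains s l t x : dec_chain (perm_stream s) l t x ->
  contains_pattern s (decreasing_perm l.+1).
Proof. by case/dec_chain_path => i [p [_ _ <-]]; apply: decreasing_path_contains. Qed.

Definition increasing_coloring d s (c : 'I_n -> 'I_d) : bool :=
  [forall a, increasing_on s [set i | c i == a]].

Lemma increasing_coloringP d s (c : 'I_n -> 'I_d) :
  reflect (forall i j, i < j -> c i = c j -> s i < s j) (increasing_coloring s c).
Proof.
apply: (iffP forallP) => [inc i j ij cij|inc a].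
  have /forall_inP/(_ i) := inc (c i); rewrite inE eqxx => /(_ isT)/forall_inP/(_ j).
  by rewrite inE cij eqxx => /(_ isT)/implyP; apply.
apply/forall_inP => i; rewrite inE => /eqP ci.
apply/forall_inP => j; rewrite inE => /eqP cj.
by apply/implyP => ij; apply: inc; rewrite ?ci ?cj.
Qed.

Lemma increasing_coloring_avoider d s (c : 'I_n -> 'I_d) :
  increasing_coloring s c -> s \in avoiders n (decreasing_perm d.+1).
Proof.
move=> /increasing_coloringP inc; rewrite inE; apply/existsP.
case=> f /andP[/forallP f_inc /forallP f_pattern].
have color_neq (a b : 'I_d.+1) : a < b -> c (f a) != c (f b).
  move=> ab; apply/eqP => cE; have /forallP/(_ b)/implyP/(_ ab) fab := f_inc a.
  have := inc _ _ fab cE; have /forallP/(_ b)/eqP -> := f_pattern a.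
  by rewrite !permE /=; lia.
have : injective (c \o f).
  move=> a b /= cE; apply/val_inj; case: (ltngtP a b) => // ab.
    by have := color_neq _ _ ab; rewrite cE eqxx.
  by have := color_neq _ _ ab; rewrite cE eqxx.
by move/leq_card; rewrite !card_ord ltnn.
Qed.

(* Color each position by the length of the longest decreasing subsequence ending there. *)
Lemma avoider_increasing_coloring e s : s \in avoiders n (decreasing_perm e.+2) ->
  exists c : {ffun 'I_n -> 'I_e.+1}, increasing_coloring s c.
Proof.
rewrite inE => avoid_s; pose chain i (l : nat) := dec_chain (perm_stream s) l i (s i).
pose depth i : 'I_e.+1 := [arg max_(l > ord0 | chain i l) l].
exists (finfun depth); apply/increasing_coloringP => i j ij; rewrite !ffunE => depth_ij.
rewrite perm_ltnNlt //; apply/negP => sji.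
have chain0 k : chain k (ord0 : 'I_e.+1) by rewrite /chain /= perm_streamE eqxx.
move: depth_ij; rewrite /depth; case: arg_maxnP => [|l chain_l _]; first exact: chain0.
case: arg_maxnP => [|l' _ l'_max ll']; first exact: chain0.
have chain_lS : chain j l.+1.
  by apply/dec_chainSP; split; [apply: perm_streamE | exists i, (s i)].
have l_lt : l.+1 < e.+1.
  rewrite ltn_neqAle ltn_ord andbT; apply: contraNneq avoid_s => le.
  by apply: dec_chain_contains; rewrite -le; apply: chain_lS.
by have := l'_max (Ordinal l_lt) chain_lS; rewrite -ll' /= ltnn.
Qed.

Lemma avoider_LIS_ge e s : s \in avoiders n (decreasing_perm e.+2) -> n <= LIS s * e.+1.
Proof.
case/avoider_increasing_coloring=> c /forallP inc.
rewrite -[leqLHS]card_ord -sum1_card (partition_big c xpredT) //= mulnC.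
rewrite -[X in (X * _)]card_ord -sum_nat_const; apply: leq_sum => a _.
by rewrite sum1_card -cardsE; apply: increasing_LIS (inc a).
Qed.

Lemma increasing_first_row s A : increasing_on s A ->
  #|A| <= #|first_row (perm_stream s) n|.
Proof.
move=> /forall_inP incA.
suff below t v : t <= n -> (#|[set a in A | a < t & s a < v]| <=
    #|[set z in first_row (perm_stream s) t | z < v]|).
  have := below n n (leqnn n); congr (_ <= _); apply: eq_card => a.
    by rewrite !inE !ltn_ord !andbT.
  by rewrite inE ltn_ord andbT.
elim: t v => [|t IH] v tn.
  by rewrite (eq_card0 (A := [set a in A | _])) // => a; rewrite !inE andbF.
pose i := Ordinal tn; have st : perm_stream s t = Some (s i) := perm_streamE s i.
rewrite /= st; case: (boolP ((i \in A) && (s i < v))) => [/andP[iA siv]|iAv].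
  apply: leq_trans (card_insert_below_lt _ siv).
  rewrite (cardsD1 i) !inE iA siv ltnSn /= add1n ltnS.
  apply: leq_trans (IH (s i) (ltnW tn)).
  apply/subset_leq_card/subsetP => a; rewrite !inE ltnS => /and4P[ai aA at_ _].
  have a_lt : a < i by rewrite ltn_neqAle ai.
  by rewrite aA a_lt; have /forall_inP/(_ i iA)/implyP := incA a aA; apply.
have fresh : s i \notin first_row (perm_stream s) t.
  apply: contra (stream_ran_fresh (@perm_stream_inj s) st).
  exact/subsetP/first_row_sub.
apply: leq_trans (card_insert_below _ fresh); apply: leq_trans (IH v (ltnW tn)).
apply/subset_leq_card/subsetP => a; rewrite !inE ltnS => /and3P[aA at_ sav].
rewrite aA sav andbT ltn_neqAle at_ andbT.
by apply: contraNneq iAv => /(@val_inj _ _ _ a i) <-; rewrite aA.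
Qed.

End Permutations.

(** * Encoding avoiders by pairs of words *)

Lemma leq_descending (P : nat -> bool) : (forall i, P i.+1 -> P i) ->
  forall i j, i <= j -> P j -> P i.
Proof. by move=> P_dec i j /subnK<-; elim: (j - i) => // l IH /P_dec. Qed.

Definition height e (P : nat -> bool) : 'I_e.+1 := inord (\sum_(j < e) P j.+1).

Lemma val_height e P : height e P = \sum_(j < e) P j.+1 :> nat.
Proof.
rewrite inordK // ltnS -[leqRHS]card_ord -sum1_card.
by apply: leq_sum => j _; case: (P _).
Qed.

Lemma leq_height e (P : nat -> bool) j : P 0 -> (forall i, P i.+1 -> P i) -> j <= e ->
  (j <= height e P) = P j.
Proof.
rewrite val_height => P0 P_dec; case: j => // j.
elim: e P P0 P_dec j => // e IH P P0 P_dec j je; rewrite big_ord_recl.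
case P1: (P 1); last first.
  have Pfalse i : P i.+1 = false := contraFF (leq_descending P_dec (ltn0Sn i)) P1.
  by rewrite Pfalse big1 // => i _; rewrite Pfalse.
case: j je => [|j] je; rewrite add1n ltnS // (IH (fun i => P i.+1)) // => i.
exact: P_dec.
Qed.

Lemma height_eq0 e (P : nat -> bool) :
  (forall i, P i.+1 -> P i) -> ~~ P 1 -> height e P = ord0.
Proof.
move=> P_dec /negPf P1; apply/val_inj; rewrite [LHS]val_height big1 // => i _.
by rewrite (contraFF (leq_descending P_dec (ltn0Sn i)) P1).
Qed.

Section Encoding.
Variables n e : nat.
Implicit Types (s : 'S_n) (w : {ffun 'I_n -> 'I_e.+1}).

Definition bumped_stream s j := iter j (@bumped n) (perm_stream s).

Lemma bumped_stream_inj s j : stream_inj (bumped_stream s j).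
Proof. exact/iter_bumped_inj/perm_stream_inj. Qed.

Lemma bumped_stream_avoider s t :
  s \in avoiders n (decreasing_perm e.+2) -> bumped_stream s e.+1 t = None.
Proof.
rewrite inE => avoid_s; case bumpE: (bumped_stream s e.+1 t) => [y|//].
have chain : dec_chain (bumped_stream s e.+1) 0 t y by apply/andP; split=> //; apply/eqP.
have [x] := dec_chain_iter_bumped (@perm_stream_inj n s) chain.
by rewrite addn0 => /dec_chain_contains; rewrite (negPf avoid_s).
Qed.

Definition position_word s : {ffun 'I_n -> 'I_e.+1} :=
  [ffun t : 'I_n => height e (fun j => isSome (bumped_stream s j t))].

Definition value_word s : {ffun 'I_n -> 'I_e.+1} :=
  [ffun y => height e (fun j => y \in stream_ran (bumped_stream s j) n)].

Lemma bumped_streamS_some s j t :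
  isSome (bumped_stream s j.+1 t) -> isSome (bumped_stream s j t).
Proof. by rewrite /bumped_stream iterS /bumped; case: (iter j _ _ t). Qed.

Lemma stream_ran_bumped_streamS s j :
  stream_ran (bumped_stream s j.+1) n \subset stream_ran (bumped_stream s j) n.
Proof. exact: stream_ran_bumped_sub. Qed.

Lemma stream_ran_perm s : stream_ran (perm_stream s) n = setT.
Proof.
apply/setP => y; rewrite in_setT; apply/stream_ranP; exists ((s^-1)%g y) => //.
by rewrite perm_streamE permKV.
Qed.

Lemma leq_position_word s j (t : 'I_n) : j <= e ->
  (j <= position_word s t) = isSome (bumped_stream s j t).
Proof.
move=> je; rewrite ffunE leq_height //; first by rewrite /bumped_stream /= perm_streamE.
by move=> i; apply: bumped_streamS_some.
Qed.

Lemma leq_value_word s j (y : 'I_n) : j <= e ->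
  (j <= value_word s y) = (y \in stream_ran (bumped_stream s j) n).
Proof.
move=> je; rewrite ffunE leq_height //; first by rewrite stream_ran_perm inE.
by move=> i; apply/subsetP/stream_ran_bumped_streamS.
Qed.

Lemma words_inj : {in avoiders n (decreasing_perm e.+2) &,
  injective (fun s => (position_word s, value_word s))}.
Proof.
move=> s s' avoid_s avoid_s' wordsE.
have positionE : position_word s = position_word s' := congr1 fst wordsE.
have valueE : value_word s = value_word s' := congr1 snd wordsE.
suff streamE j : j <= e.+1 -> {in gtn n, bumped_stream s j =1 bumped_stream s' j}.
  by apply/permP => i; have := streamE 0 isT i (ltn_ord i); rewrite /= !perm_streamE => -[].
move=> je; rewrite -(subKn je); elim: (e.+1 - j) (leq_subr j e.+1) => [_ t _|i IH ie].
  by rewrite subn0 !bumped_stream_avoider.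
have := IH (ltnW ie); rewrite subSS (subSn (ie : i <= e)).
move: (e - i) (leq_subr i e) => l le {}IH.
apply: stream_recover IH _; try exact: bumped_stream_inj.
- move=> t tn; rewrite -[t]/(nat_of_ord (Ordinal tn)) -(leq_position_word s _ le).
  by rewrite -(leq_position_word s' _ le) positionE.
- by apply/setP => y; rewrite -(leq_value_word s y le) -(leq_value_word s' y le) valueE.
Qed.

Definition zeros w := #|[set t | w t == ord0]|.

Lemma first_row_zeros_value s : #|first_row (perm_stream s) n| <= zeros (value_word s).
Proof.
rewrite first_row_ran; last exact: perm_stream_inj.
apply/subset_leq_card/subsetP => y; rewrite in_setD => /andP[ybumped _].
by rewrite inE ffunE height_eq0 // => j; apply/subsetP/stream_ran_bumped_streamS.
Qed.

Lemma first_row_zeros_position s :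
  #|first_row (perm_stream s) n| <= zeros (position_word s).
Proof.
rewrite first_row_ran; last exact: perm_stream_inj.
rewrite stream_ran_perm setTD cardsCs setCK.
rewrite -(card_stream_dom n (@bumped_stream_inj s 1)) card_ord -[X in (X - _)]card_ord.
rewrite -cardsT -cardsDS ?subsetT // setTD.
apply/subset_leq_card/subsetP => t; rewrite !inE ffunE => t_bumped.
by rewrite height_eq0 // => j; apply: bumped_streamS_some.
Qed.

Lemma card_avoiders_LIS (P : pred nat) : {homo P : a b / a <= b >-> a ==> b} ->
  (#|[set s in avoiders n (decreasing_perm e.+2) | P (LIS s)]| <=
     #|[set w | P (zeros w)]| ^ 2).
Proof.
move=> P_up; rewrite -mulnn -cardsX.
rewrite -(@card_in_imset _ _ (fun s => (position_word s, value_word s))); last first.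
  by move=> s s'; rewrite !inE => /andP[sA _] /andP[s'A _]; apply: words_inj; rewrite inE.
apply/subset_leq_card/subsetP => _ /imsetP[s + ->]; rewrite inE => /andP[_ P_LIS].
have [A incA AE] := LIS_witness s; have := increasing_first_row incA; rewrite AE => LIS_row.
have P_zeros w : (#|first_row (perm_stream s) n| <= zeros w) -> P (zeros w).
  by move=> /(leq_trans LIS_row)/P_up/implyP; apply.
by rewrite !inE /= !P_zeros ?first_row_zeros_value ?first_row_zeros_position.
Qed.

End Encoding.

(** * Permutations from pairs of words *)

Lemma sum_count_mem (J : finType) (u : seq J) : \sum_i count_mem i u = size u.
Proof.
elim: u => [|x u IH]; first by rewrite big1.
rewrite /= big_split /= IH (bigD1 x) //= eqxx big1 // => i ix.
by rewrite eq_sym (negPf ix).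
Qed.

Lemma size_permutations_multinomial (J : finType) (u : seq J) :
  size (permutations u) * \prod_i (count_mem i u)`! = (size u)`!.
Proof.
have [m] := ubnP (size u); elim: m u => // m IH u; rewrite ltnS => um.
case: (posnP (size u)) => [/size0nil->|u_gt0]; first by rewrite big1.
rewrite (perm_size (permutationsE u_gt0)) size_allpairs_dep sumnE big_map big_distrl /=.
rewrite (eq_big_seq (fun x => (size u).-1`! * count_mem x u)); last first.
  move=> x; rewrite mem_undup => xu.
  have rem_lt : size (rem x u) < m by rewrite size_rem // prednK.
  rewrite -(size_rem xu) -(IH _ rem_lt) -mulnA; congr (_ * _).
  rewrite (bigD1 x) // [in RHS](bigD1 x) //= count_rem xu /= eqxx subn1.
  have xu_gt0 : 0 < count_mem x u by rewrite -has_count has_pred1.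
  rewrite -[X in X`! * _](prednK xu_gt0) factS prednK // [RHS]mulnC -!mulnA.
  congr (_ * (_ * _)); apply: eq_bigr => i /negPf ix.
  by rewrite count_rem xu /= eq_sym ix subn0.
rewrite -big_distrr /= (big_uniq _ (undup_uniq u)) /= -[in RHS](prednK u_gt0) factS mulnC.
rewrite prednK //; congr (_ * _); rewrite -[RHS]sum_count_mem big_mkcond /=.
by apply: eq_bigr => i _; rewrite mem_undup; case: ifP => // /negbT/count_memPn.
Qed.

Lemma size_permutations_gt0 (J : eqType) (u : seq J) : 0 < size (permutations u).
Proof. by rewrite -has_predT; apply/hasP; exists u; rewrite ?mem_permutations. Qed.

Definition content_seq (J : finType) (h : J -> nat) : seq J :=
  flatten [seq nseq (h i) i | i <- enum J].

Lemma count_content_seq (J : finType) (h : J -> nat) i : count_mem i (content_seq h) = h i.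
Proof.
rewrite count_flatten -map_comp sumnE big_map big_enum /=.
rewrite (bigD1 i) //= count_nseq /= eqxx mul1n big1 ?addn0 // => j ji.
by rewrite count_nseq /= (negPf ji).
Qed.

Lemma eq_content_seq (J : finType) (h h' : J -> nat) : h =1 h' ->
  content_seq h = content_seq h'.
Proof. by move=> hE; congr flatten; apply: eq_map => i; rewrite hE. Qed.

Lemma count_mem_take_lt (J : eqType) (a : J) (u : seq J) x : x < size u ->
  count_mem (nth a u x) (take x u) < count_mem (nth a u x) u.
Proof.
move=> xu; rewrite -[X in _ < count _ X](cat_take_drop x u) count_cat.
by rewrite (drop_nth a xu) /= eqxx -addSnnS leq_addr.
Qed.

Lemma divn_complement a b r r' : 0 < b -> r + r' + 1 = a * b -> r %/ b + r' %/ b = a.-1.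
Proof.
move=> b0; rewrite {1}(divn_eq r b) {1}(divn_eq r' b).
have := ltn_pmod r b0; have := ltn_pmod r' b0.
move: (r %/ b) (r %% b) (r' %/ b) (r' %% b) => q p q' p'; nia.
Qed.

Lemma ltn_rev_ord n (x y : 'I_n) : (rev_ord x < rev_ord y) = (y < x).
Proof. by rewrite /=; have := ltn_ord x; have := ltn_ord y; lia. Qed.

Section Occurrences.
Variable e : nat.
Implicit Types (u w : seq 'I_e.+1) (i : 'I_e.+1) (x y : nat).

Definition letter u x : 'I_e.+1 := nth ord0 u x.
Definition occ_rank u x := count_mem (letter u x) (take x u).

Lemma occ_rank_lt u x y : x < y -> y <= size u -> letter u x = letter u y ->
  occ_rank u x < occ_rank u y.
Proof.
move=> xy yu uE; rewrite /occ_rank -uE /letter.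
rewrite -(take_takel u (ltnW xy)) -(nth_take ord0 xy).
by apply: count_mem_take_lt; rewrite size_takel.
Qed.

Lemma occ_rank_inj u x y : x < size u -> y < size u ->
  letter u x = letter u y -> occ_rank u x = occ_rank u y -> x = y.
Proof.
move=> xu yu uE rE; case: (ltngtP x y) => // lt.
  by have := occ_rank_lt lt (ltnW yu) uE; rewrite rE ltnn.
by have := occ_rank_lt lt (ltnW xu) (esym uE); rewrite rE ltnn.
Qed.

Lemma occ_rank_surj u i r : r < count_mem i u ->
  exists x, [/\ x < size u, letter u x = i & occ_rank u x = r].
Proof.
rewrite /occ_rank /letter; elim: u r => //= j u IH r.
case: (eqVneq j i) => [->|ji]; last first.
  by case/IH=> x [xu ux]; rewrite ux => rx; exists x.+1; rewrite /= ux (negPf ji).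
case: r => [|r]; first by exists 0.
rewrite add1n ltnS => /IH[x [xu ux]]; rewrite ux => rx.
by exists x.+1; rewrite /= ux eqxx rx.
Qed.

(* The word w is read backwards in the values: the r-th occurrence of a letter in u
   goes to its r-th last occurrence in w, hence increasingly. *)
Definition matched n u w (x y : 'I_n) : bool :=
  (letter w (rev_ord y) == letter u x) &&
  (occ_rank u x + occ_rank w (rev_ord y) + 1 == count_mem (letter u x) u).

Definition matching n u w : 'S_n :=
  odflt 1%g [pick s : 'S_n | [forall x, matched u w x (s x)]].

Lemma matchedP n u w (x y : 'I_n) :
  reflect (letter w (rev_ord y) = letter u x /\
     occ_rank u x + occ_rank w (rev_ord y) + 1 = count_mem (letter u x) u)
    (matched u w x y).
Proof. by apply: (iffP andP) => -[/eqP ? /eqP ?]. Qed.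

Lemma exists_matched n u w (x : 'I_n) : size u = n -> perm_eq u w ->
  exists y : 'I_n, matched u w x y.
Proof.
move=> un uw; have [r rE] : exists r, occ_rank u x + r + 1 = count_mem (letter u x) u.
  exists (count_mem (letter u x) u - (occ_rank u x).+1).
  by rewrite addn1 -addSn subnKC // count_mem_take_lt ?un.
have [|y [yw wy ry]] := @occ_rank_surj w (letter u x) r.
  by rewrite -(seq.permP uw) -rE addn1 ltnS leq_addl.
rewrite -(perm_size uw) un in yw; exists (rev_ord (Ordinal yw)).
by apply/matchedP; rewrite rev_ordK /= wy ry.
Qed.

Lemma matched_inj n u w (x x' y : 'I_n) : size u = n ->
  matched u w x y -> matched u w x' y -> x = x'.
Proof.
move=> un /matchedP[wx rx] /matchedP[wx' rx'].
have uE : letter u x = letter u x' by rewrite -wx.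
by apply/val_inj/(occ_rank_inj _ _ uE); rewrite ?un //; move: rx rx'; rewrite uE; lia.
Qed.

Lemma matchingP n u w (x : 'I_n) : size u = n -> perm_eq u w ->
  matched u w x (matching n u w x).
Proof.
move=> un uw; suff /forallP : [forall x, matched u w x (matching n u w x)] by [].
rewrite /matching; case: pickP => //= no_matching.
have [f f_matched] := fin_all_exists (fun x : 'I_n => exists_matched x un uw).
have f_inj : injective f.
  by move=> y z fE; apply: (matched_inj un (f_matched y)); rewrite fE.
have /negP[] := no_matching (perm f_inj).
by apply/forallP => y; rewrite permE.
Qed.

End Occurrences.

(* Hence the color of a position is the maximal number of terms that precede it in a
   decreasing subsequence ending there, and s determines the coloring. *)
Definition greedy_coloring n (s : 'S_n) (c : 'I_n -> nat) : Prop :=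
  (forall x y : 'I_n, x < y -> s y < s x -> c x < c y) /\
  (forall y : 'I_n, 0 < c y -> exists x : 'I_n, [/\ x < y, s y < s x & c y = (c x).+1]).

Lemma greedy_coloring_le n (s : 'S_n) c c' :
  greedy_coloring s c -> greedy_coloring s c' -> forall x, c x <= c' x.
Proof.
move=> [_ pred_c] [inv_c' _] x.
have [m] := ubnP x; elim: m x => // m IH x; rewrite ltnS => xm.
case: (posnP (c x)) => [->//|/pred_c[y [yx sxy ->]]].
exact: leq_ltn_trans (IH y (leq_trans yx xm)) (inv_c' _ _ yx sxy).
Qed.

Lemma greedy_coloring_uniq n (s : 'S_n) c c' :
  greedy_coloring s c -> greedy_coloring s c' -> c =1 c'.
Proof.
by move=> gc gc' x; apply: anti_leq; rewrite !(greedy_coloring_le (s := s)).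
Qed.

Section Balanced.
Variables (e T : nat) (g : 'I_e.+1 -> nat).
Hypothesis g_gt0 : forall i, 0 < g i.
Implicit Types (u w : seq 'I_e.+1).

Local Notation n := (T * \sum_i g i).

Definition batch u x := occ_rank u x %/ g (letter u x).
Definition block u x := letter u x + batch u x.

(* The t-th batch of g i consecutive occurrences of the letter i sits in block t + i. *)
Definition balanced u : Prop :=
  (forall i, count_mem i u = T * g i) /\
  (forall x y, x < y < size u -> block u x <= block u y).

Lemma balanced_size u : balanced u -> size u = n.
Proof. by case=> uT _; rewrite -sum_count_mem big_distrr; apply: eq_bigr. Qed.

Lemma balanced_perm_eq u w : balanced u -> balanced w -> perm_eq u w.
Proof. by move=> [uT _] [wT _]; apply/allP => i _; rewrite /= uT wT. Qed.

Lemma balanced_batch_lt u x : balanced u -> x < size u -> batch u x < T.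
Proof. by move=> [uT _] xu; rewrite /batch ltn_divLR // -uT count_mem_take_lt. Qed.

Section Pair.
Variables u w : seq 'I_e.+1.
Hypotheses (ub : balanced u) (wb : balanced w).

Local Notation s := (matching n u w).

Let un : size u = n := balanced_size ub.

Let s_matched (x : 'I_n) :
  letter w (rev_ord (s x)) = letter u x /\
  occ_rank u x + occ_rank w (rev_ord (s x)) + 1 = T * g (letter u x).
Proof.
by have /matchedP := matchingP x un (balanced_perm_eq ub wb); rewrite ub.1.
Qed.

Lemma matching_letter (x : 'I_n) : letter w (rev_ord (s x)) = letter u x.
Proof. exact: (s_matched x).1. Qed.

Lemma matching_batch (x : 'I_n) : batch u x + batch w (rev_ord (s x)) = T.-1.
Proof.
by have [wx rx] := s_matched x; rewrite /batch wx; apply: divn_complement.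
Qed.

Lemma matching_increasing (x y : 'I_n) : x < y -> letter u x = letter u y -> s x < s y.
Proof.
move=> xy uE; have rank_xy : occ_rank u x < occ_rank u y.
  by apply: occ_rank_lt; rewrite ?un // ltnW.
rewrite perm_ltnNlt //; apply/negP => syx.
rewrite -ltn_rev_ord in syx; have wn : size w = n := balanced_size wb.
have := @occ_rank_lt e w _ _ syx; rewrite wn !matching_letter => /(_ (ltnW (ltn_ord _)) uE).
by have [_] := s_matched x; have [_] := s_matched y; rewrite uE; lia.
Qed.

Lemma matching_block (x : 'I_n) :
  block w (rev_ord (s x)) + batch u x = letter u x + T.-1.
Proof. by rewrite -(matching_batch x) /block matching_letter; lia. Qed.

Lemma matching_greedy : greedy_coloring s (fun x => letter u x).
Proof.
have block_le (x y : 'I_n) : x < y -> block u x <= block u y.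
  by move=> xy; apply: ub.2; rewrite xy un /=.
have rev_block_le (x y : 'I_n) :
    s y < s x -> block w (rev_ord (s x)) <= block w (rev_ord (s y)).
  by rewrite -ltn_rev_ord => sxy; apply: wb.2; rewrite sxy (balanced_size wb) ltn_ord.
split=> [x y xy syx|y uy].
  have uxy : letter u x != letter u y.
    by apply: contraTneq syx => /(matching_increasing xy) sxy; rewrite -leqNgt ltnW.
  have := block_le x y xy; have := rev_block_le x y syx; rewrite /block.
  have := matching_block x; have := matching_block y; rewrite /block.
  by move: uxy; rewrite -val_eqE /=; lia.
have pred_lt : (letter u y).-1 < e.+1 by apply: leq_trans (ltn_ord (letter u y)); lia.
pose i := Ordinal pred_lt; have [|x [xu ux rx]] := @occ_rank_surj e u i (batch u y * g i).
  by rewrite ub.1 ltn_pmul2r // balanced_batch_lt ?un.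
rewrite un in xu; pose x' := Ordinal xu.
have batchE : batch u x' = batch u y by rewrite /batch ux rx mulnK.
have uE : letter u y = (letter u x').+1 :> nat by rewrite ux /= prednK.
have xy : x' < y.
  rewrite ltnNge leq_eqVlt; apply/negP => /predU1P[/val_inj yx|/block_le].
    by move: uE; rewrite -yx; lia.
  by rewrite /block batchE uE; lia.
exists x'; split=> //.
rewrite -[s y < s x']negbK -perm_ltnNlt //; apply/negP => /rev_block_le.
by have := matching_block x'; have := matching_block y; rewrite uE batchE; lia.
Qed.

End Pair.

Lemma matching_inj u w u' w' :
  balanced u -> balanced w -> balanced u' -> balanced w' ->
  matching n u w = matching n u' w' -> u = u' /\ w = w'.
Proof.
move=> ub wb ub' wb' sE.
have uE : u = u'.
  apply: (@eq_from_nth _ ord0) => [|x]; rewrite (balanced_size ub) ?balanced_size // => xn.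
  have gu' := matching_greedy ub' wb'; rewrite -sE in gu'.
  exact/val_inj/(greedy_coloring_uniq (matching_greedy ub wb) gu' (Ordinal xn)).
split=> //.
apply: (@eq_from_nth _ ord0) => [|x]; rewrite (balanced_size wb) ?balanced_size // => xn.
set s := matching _ u w in sE; pose y := (s^-1)%g (rev_ord (Ordinal xn)).
have <- : rev_ord (s y) = x :> nat by rewrite permKV rev_ordK.
by have := matching_letter ub' wb' y; rewrite -sE -uE -(matching_letter ub wb y).
Qed.

End Balanced.

Section BlockWords.
Variables (e T : nat) (g : 'I_e.+1 -> nat).
Hypothesis g_gt0 : forall i, 0 < g i.
Implicit Types (u v : seq 'I_e.+1) (i : 'I_e.+1).

Definition block_content r i : nat := if i <= r < T + i then g i else 0.

Fixpoint block_words r : seq (seq 'I_e.+1) :=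
  if r is r'.+1 then
    [seq u ++ v | u <- block_words r', v <- permutations (content_seq (block_content r'))]
  else [:: [::]].

Lemma block_wordsSP r u : u \in block_words r.+1 -> exists v v',
  [/\ v \in block_words r, forall i, count_mem i v' = block_content r i & u = v ++ v'].
Proof.
case/allpairsP => -[v v'] /= [vW + ->]; rewrite mem_permutations => /seq.permP v'E.
by exists v, v'; split=> // i; rewrite v'E count_content_seq.
Qed.

Lemma block_words_count r u i : u \in block_words r -> count_mem i u = g i * minn T (r - i).
Proof.
elim: r u => [|r IH] u; first by rewrite inE => /eqP->; rewrite /= sub0n minn0 muln0.
case/block_wordsSP => v [v' [vW v'E ->]]; rewrite count_cat IH // v'E /block_content.
by case: ifP => ir; rewrite ?addn0 -?mulnSr; congr (_ * _); lia.
Qed.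

Lemma block_words_size r u : u \in block_words r -> size u = \sum_i g i * minn T (r - i).
Proof.
by move=> uW; rewrite -sum_count_mem; apply: eq_bigr => i _; apply: block_words_count.
Qed.

Lemma block_words_uniq r : uniq (block_words r).
Proof.
elim: r => // r IH; apply: allpairs_uniq => //; first exact: permutations_uniq.
move=> _ _ /allpairsP[[u v] /= [uW _ ->]] /allpairsP[[u' v'] /= [u'W _ ->]] /= /eqP.
rewrite eqseq_cat ?(block_words_size uW) ?(block_words_size u'W) //.
by case/andP=> /eqP-> /eqP->.
Qed.

Lemma block_words_block r u : u \in block_words r ->
  (forall x, x < size u -> block g u x < r) /\
  (forall x y, x < y < size u -> block g u x <= block g u y).
Proof.
elim: r u => [|r IH] u; first by rewrite inE => /eqP->; split=> // x y /andP[].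
case/block_wordsSP => v [v' [vW v'E ->]]; have [lt_r mono] := IH v vW.
have block_left x : x < size v -> block g (v ++ v') x = block g v x.
  by move=> xv; rewrite /block /batch /occ_rank /letter nth_cat xv take_cat xv.
have block_right x : size v <= x < size (v ++ v') -> block g (v ++ v') x = r.
  rewrite size_cat => /andP[vx xs].
  rewrite /block /batch /occ_rank /letter nth_cat take_cat ltnNge vx /=.
  have xv' : x - size v < size v' by lia.
  have := count_mem_take_lt ord0 xv'; set i := nth ord0 v' _.
  rewrite v'E /block_content; case: ifP => // ir lt_g.
  by rewrite count_cat (block_words_count i vW) mulnC divnMDl // divn_small //; lia.
split=> [x|x y]; rewrite size_cat => xs.
  case: (ltnP x (size v)) => xv; first by rewrite block_left // (leq_trans (lt_r x xv)).
  by rewrite block_right // xv size_cat.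
case/andP: xs => xy ys; case: (ltnP y (size v)) => yv.
  by rewrite !block_left ?mono ?xy // (ltn_trans xy).
rewrite (block_right y); last by rewrite yv size_cat.
case: (ltnP x (size v)) => xv; first by rewrite block_left // ltnW // lt_r.
by rewrite block_right // xv size_cat (ltn_trans xy).
Qed.

Lemma block_words_balanced u : u \in block_words (T + e) -> balanced T g u.
Proof.
move=> uW; split=> [i|]; last by case: (block_words_block uW).
by rewrite (block_words_count i uW) mulnC; congr (_ * _); have := ltn_ord i; lia.
Qed.

Lemma size_block_words r :
  size (block_words r) =
    \prod_(0 <= k < r) size (permutations (content_seq (block_content k))).
Proof.
by elim: r => [|r IH]; rewrite ?big_nil // big_nat_recr //= -IH size_allpairs.
Qed.

Lemma size_block_words_ge :
  size (permutations (content_seq g)) ^ (T - e) <= size (block_words (T + e)).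
Proof.
have prod_gt0 a b :
    0 < \prod_(a <= k < b) size (permutations (content_seq (block_content k))).
  by rewrite prodn_gt0 // => k; apply: size_permutations_gt0.
rewrite size_block_words; case: (leqP T e) => [Te|eT].
  by rewrite (eqP (Te : T - e == 0)) prod_gt0.
rewrite (@big_cat_nat _ _ _ T) ?leq_addr //= (@big_cat_nat _ _ _ e) //=; last exact: ltnW.
rewrite [X in _ * X * _](eq_big_nat _ _ (F2 := fun=> size (permutations (content_seq g)))).
  by rewrite prod_nat_const_nat -mulnA mulnCA leq_pmulr // muln_gt0 !prod_gt0.
move=> k /andP[ek kT]; congr (size (permutations _)); apply: eq_content_seq => i.
by rewrite /block_content ifT //; have := ltn_ord i; lia.
Qed.

End BlockWords.

Section Colorable.
Variable e : nat.

Definition colorable n a : {set 'S_n} :=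
  [set s : 'S_n | [exists c : {ffun 'I_n -> 'I_e.+1},
     increasing_coloring s c && (a <= zeros c)]].

Lemma colorable_avoider n a :
  colorable n a \subset [set s in avoiders n (decreasing_perm e.+2) | a <= LIS s].
Proof.
apply/subsetP => s; rewrite inE => /existsP[c /andP[inc ac]].
rewrite inE (increasing_coloring_avoider inc) (leq_trans ac) // increasing_LIS //.
exact: (forallP inc).
Qed.

Lemma zeros_seq n (u : seq 'I_e.+1) : size u = n ->
  zeros [ffun x : 'I_n => letter u x] = count_mem ord0 u.
Proof.
move=> un; rewrite -[in RHS](mkseq_nth ord0 u) un /mkseq -val_enum_ord -map_comp count_map.
rewrite /zeros cardsE cardE size_filter -enumT; apply: eq_count => x.
by rewrite !inE unfold_in /= ffunE.
Qed.

Lemma card_colorable_matching T (g : 'I_e.+1 -> nat) (W : seq (seq 'I_e.+1)) :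
  (forall i, 0 < g i) -> uniq W -> {in W, forall u, balanced T g u} ->
  size W ^ 2 <= #|colorable (T * \sum_i g i) (T * g ord0)|.
Proof.
move=> g_gt0 W_uniq Wb.
rewrite -mulnn -(size_allpairs (@matching e (T * \sum_i g i))) cardE.
apply: uniq_leq_size.
  apply: allpairs_uniq => // -[u w] [u' w'] /allpairsP[[? ?] [/= uW wW [-> ->]]].
  move=> /allpairsP[[? ?] [/= u'W w'W [-> ->]]] /= E.
  by have [-> ->] := matching_inj g_gt0 (Wb _ uW) (Wb _ wW) (Wb _ u'W) (Wb _ w'W) E.
move=> _ /allpairsP[[u w] [/= /Wb ub /Wb wb ->]]; rewrite mem_enum inE.
apply/existsP; exists [ffun x : 'I_ _ => letter u x].
rewrite (zeros_seq (balanced_size ub)) ub.1 leqnn andbT.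
by apply/increasing_coloringP => x y xy; rewrite !ffunE; apply: (matching_increasing ub wb).
Qed.

Lemma card_colorableS n a : #|colorable n a| <= #|colorable n.+1 a.+1|.
Proof.
have lift_perm_inj : injective (@lift_perm n ord_max ord_max).
  move=> s s' sE; apply/permP => i; apply: (@lift_inj _ ord_max).
  by rewrite -!(lift_perm_lift ord_max) sE.
rewrite -(card_imset _ lift_perm_inj).
apply/subset_leq_card/subsetP => _ /imsetP[s + ->]; rewrite !inE.
case/existsP=> c /andP[/increasing_coloringP inc ac]; apply/existsP.
exists [ffun i => if unlift ord_max i is Some j then c j else ord0]; apply/andP; split.
  apply/increasing_coloringP => i j; rewrite !ffunE.
  case: (unliftP ord_max i) => [i'|] ->; case: (unliftP ord_max j) => [j'|] ->.
  - by rewrite !lift_perm_lift !lift_max; apply: inc.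
  - by move=> _ _; rewrite lift_perm_lift lift_perm_id lift_max /=.
  - by rewrite lift_max /= ltnNge ltnW.
  - by rewrite ltnn.
rewrite /zeros (cardsD1 ord_max) inE ffunE unlift_none eqxx add1n ltnS.
apply: leq_trans ac _.
rewrite /zeros -(card_imset [set x | c x == _] (@lift_inj _ ord_max)).
apply/subset_leq_card/subsetP => _ /imsetP[i + ->].
by rewrite !inE ffunE liftK => ->; rewrite eq_sym neq_lift.
Qed.

Lemma card_colorableD n a r : #|colorable n a| <= #|colorable (n + r) (a + r)|.
Proof.
elim: r => [|r IH]; first by rewrite !addn0.
by rewrite !addnS; apply: leq_trans IH (card_colorableS _ _).
Qed.

Lemma card_colorable_ge T (g : 'I_e.+1 -> nat) r : (forall i, 0 < g i) ->
  size (permutations (content_seq g)) ^ (2 * (T - e)) <=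
    #|colorable (T * \sum_i g i + r) (T * g ord0 + r)|.
Proof.
move=> g_gt0; apply: leq_trans (card_colorableD _ _ _).
rewrite mulnC expnM.
apply: leq_trans (card_colorable_matching g_gt0 (block_words_uniq T g (T + e)) _).
  by rewrite leq_exp2r // size_block_words_ge.
by move=> u; apply: block_words_balanced.
Qed.

End Colorable.

Local Open Scope ring_scope.

(** * Entropy estimates *)

Section Entropy.
Variable R : realType.
Implicit Types (x c eps : R).

Lemma ln_lt_sub1 x : 0 < x -> x != 1 -> ln x < x - 1.
Proof.
move=> x0 x1; have lnx0 : ln x != 0 by rewrite ln_eq0.
by have := expR_gt1Dx lnx0; rewrite lnK //; lra.
Qed.

Lemma ln_le_sub1 x : 0 < x -> ln x <= x - 1.
Proof. by move=> x0; have := @le_ln1Dx R (x - 1); rewrite subrKC; apply; lra. Qed.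

Lemma ln_succ_le x : 0 < x -> x * (ln (x + 1) - ln x) <= 1.
Proof.
move=> x0; rewrite -ln_div ?posrE //; last lra.
have := ler_wpM2l (ltW x0) (@ln_le_sub1 ((x + 1) / x) _).
rewrite (_ : x * ((x + 1) / x - 1) = 1); last by field; rewrite gt_eqF.
by apply; rewrite divr_gt0 //; lra.
Qed.

Lemma ln_succ_ge x : 0 < x -> 1 <= (x + 1) * (ln (x + 1) - ln x).
Proof.
move=> x0; have x1 : 0 < x + 1 by lra.
have := ler_wpM2l (ltW x1) (@ln_le_sub1 (x / (x + 1)) _); rewrite ln_div ?posrE //.
rewrite (_ : (x + 1) * (x / (x + 1) - 1) = - 1); last by field; rewrite gt_eqF.
by move=> /(_ (divr_gt0 x0 x1)); lra.
Qed.

Lemma ln_factS n : ln n.+1`!%:R = ln n.+1%:R + ln n`!%:R :> R.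
Proof. by rewrite factS natrM lnM // posrE ltr0n ?fact_gt0. Qed.

Lemma ln_fact_ge n : n%:R * ln n%:R - n%:R <= ln n`!%:R :> R.
Proof.
elim: n => [|[_|n IH]]; [by rewrite fact0 ln1; lra | by rewrite ln1; lra |].
have := @ln_succ_le n.+1%:R (ltr0Sn _ _).
by rewrite ln_factS -[n.+2%:R]natr1; lra.
Qed.

(* Valid at n = 0 because ln 0 = 0. *)
Lemma ln_fact_le n : ln n`!%:R <= n.+1%:R * ln n%:R - n%:R + 1 :> R.
Proof.
elim: n => [|[_|n IH]]; [by rewrite fact0 ln1 ln0 //; lra | by rewrite ln1; lra |].
have := @ln_succ_ge n.+1%:R (ltr0Sn _ _).
by rewrite ln_factS; move: IH; rewrite -[n.+3%:R]natr1 -[n.+2%:R]natr1; lra.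
Qed.

Lemma ln_natr_prod (J : finType) (h : J -> nat) : (forall i, (0 < h i)%N) ->
  ln (\prod_i h i)%:R = \sum_i ln (h i)%:R :> R.
Proof.
move=> h_gt0; rewrite natr_prod -[RHS]expRK expR_sum; congr ln.
by apply: eq_bigr => i _; rewrite lnK // posrE ltr0n.
Qed.

Lemma ln_multinomial_ge (J : finType) (u : seq J) :
  (size u)%:R * ln (size u)%:R - \sum_i (count_mem i u)%:R * ln (count_mem i u)%:R
    - #|J|%:R * (ln (size u)%:R + 1) <= ln (size (permutations u))%:R :> R.
Proof.
case: (posnP (size u)) => [u0|u_gt0].
  rewrite u0 ln0 // mul0r big1 => [|i _]; last first.
    by have := count_size (pred1 i) u; rewrite u0 leqn0 => /eqP->; rewrite mul0r.
  have := ln_ge0 (_ : 1 <= (size (permutations u))%:R :> R).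
  by rewrite ler1n size_permutations_gt0 => /(_ isT); have := ler0n R #|J|; lra.
have fact_prod_gt0 : (0 < \prod_i (count_mem i u)`!)%N.
  by rewrite prodn_gt0 // => i; apply: fact_gt0.
have lnE : ln (size (permutations u))%:R + \sum_i ln (count_mem i u)`!%:R =
    ln (size u)`!%:R :> R.
  rewrite -ln_natr_prod => [|i]; last exact: fact_gt0.
  by rewrite -size_permutations_multinomial natrM lnM ?posrE ?ltr0n ?size_permutations_gt0.
have count_le i : ln (count_mem i u)`!%:R <=
    (count_mem i u)%:R * ln (count_mem i u)%:R - (count_mem i u)%:R
      + (ln (size u)%:R + 1) :> R.
  apply: le_trans (ln_fact_le _) _; rewrite -natr1.
  have : ln (count_mem i u)%:R <= ln (size u)%:R :> R; last lra.
  case: (posnP (count_mem i u)) => [->|ci_gt0]; first by rewrite ln0 // ln_ge0 // ler1n.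
  by rewrite ler_ln ?posrE ?ltr0n // ler_nat count_size.
have := ler_sum _ (fun i _ => count_le i) : (\sum_i _ <= \sum_i _).
rewrite big_split sumrB -natr_sum sum_count_mem sumr_const -[(_ + 1) *+ _]mulr_natl /=.
by have := ln_fact_ge (size u); rewrite -lnE; lra.
Qed.

Lemma near_ln_le (a eta : R) : 0 < a -> 0 < eta ->
  (\forall n \near \oo, a * (ln n%:R + 1) <= n%:R * eta)%classic.
Proof.
move=> a_gt0 eta_gt0; pose t := eta / (2 * a).
have t_gt0 : 0 < t by rewrite divr_gt0 // mulr_gt0.
near=> n.
have n_gt0 : 0 < n%:R :> R by rewrite ltr0n; near: n; apply: nbhs_infty_gt.
have n_large : - (2 * a * ln t / eta) <= n%:R by near: n; apply: nbhs_infty_ger.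
have : a * ln (t * n%:R) <= a * (t * n%:R - 1).
  by rewrite ler_pM2l // ln_le_sub1 // mulr_gt0.
rewrite lnM ?posrE // (_ : a * (t * n%:R - 1) = n%:R * eta / 2 - a); last first.
  by rewrite /t; field; rewrite gt_eqF.
by move: n_large; rewrite -mulNr ler_pdivrMr //; lra.
Unshelve. all: by end_near. Qed.

(* The entropy of the distribution (c, (1 - c) / e, ..., (1 - c) / e) on e + 1 letters. *)
Definition peak_entropy (e : nat) c : R := - (c * ln c + (1 - c) * ln ((1 - c) / e%:R)).

Lemma peak_entropy_uniform e : (0 < e)%N -> peak_entropy e e.+1%:R^-1 = ln e.+1%:R.
Proof.
move=> e0; have e_gt0 : 0 < e%:R :> R by rewrite ltr0n.
have d_gt0 : 0 < e.+1%:R :> R by rewrite ltr0n.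
rewrite /peak_entropy.
have -> : (1 - e.+1%:R^-1) / e%:R = e.+1%:R^-1 :> R.
  by rewrite -natr1; field; rewrite natr1 !gt_eqF.
by rewrite lnV ?posrE //; ring.
Qed.

Lemma peak_entropy_lt e c : e.+1%:R^-1 < c < 1 -> peak_entropy e c < ln e.+1%:R.
Proof.
move=> /andP[c_gt c_lt]; have d_gt0 : 0 < e.+1%:R :> R by rewrite ltr0n.
have c_gt0 : 0 < c by apply: lt_trans c_gt; rewrite invr_gt0.
have e_gt0 : 0 < e%:R :> R.
  by move: c_gt; rewrite ltr0n; case: posnP => // ->; rewrite invr1; lra.
have gibbs_peak : ln (e.+1%:R * c)^-1 < (e.+1%:R * c)^-1 - 1.
  apply: ln_lt_sub1; first by rewrite invr_gt0 mulr_gt0.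
  by rewrite invr_eq1 gt_eqF // -ltr_pdivrMl // mulr1.
have gibbs_rest := @ln_le_sub1 (e%:R / (e.+1%:R * (1 - c))).
have rest_gt0 : 0 < e.+1%:R * (1 - c) by rewrite mulr_gt0 // subr_gt0.
move: gibbs_rest; rewrite divr_gt0 // => /(_ isT); move: gibbs_peak.
rewrite /peak_entropy ln_div ?posrE ?lnV ?ln_div ?lnM ?posrE ?mulr_gt0 ?subr_gt0 //.
rewrite -(ltr_pM2l c_gt0) -(@ler_pM2l _ (1 - c)) ?subr_gt0 //.
have -> : c * ((e.+1%:R * c)^-1 - 1) = e.+1%:R^-1 - c by field; rewrite !gt_eqF.
have -> : (1 - c) * (e%:R / (e.+1%:R * (1 - c)) - 1) = 1 - e.+1%:R^-1 - (1 - c).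
  by rewrite -natr1; field; rewrite natr1 !gt_eqF // subr_gt0.
move: (e.+1%:R^-1) (ln e.+1%:R) => q L; lra.
Qed.

Lemma frequency_gt0_lt1 e c : e.+1%:R^-1 <= c < 1 -> 0 < c < 1.
Proof. by case/andP=> c_ge ->; rewrite (lt_le_trans _ c_ge) // invr_gt0. Qed.

Lemma peak_frequency_itv e eps : 0 < eps -> eps < e%:R ->
  e.+1%:R^-1 < (1 + eps) / e.+1%:R < 1.
Proof.
move=> eps_gt0 eps_lt; rewrite ltr_pMl ?invr_gt0 ?ltr0n // ltr_pdivrMr ?ltr0n //.
by rewrite -natr1; apply/andP; split; lra.
Qed.

Lemma peak_entropy_rate e eps : 0 < eps -> eps < e%:R ->
  expR (2 * (peak_entropy e ((1 + eps) / e.+1%:R) - ln e.+1%:R)) =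
  ((1 + eps) `^ (1 + eps) * (1 - eps / e%:R) `^ (e%:R - eps)) `^ (- (2 / e.+1%:R)).
Proof.
move=> eps_gt0 eps_lt; have e_gt0 : 0 < e%:R :> R by apply: lt_trans eps_lt.
have d_gt0 : 0 < e.+1%:R :> R by rewrite ltr0n.
have peak_gt0 : 0 < 1 + eps by lra.
have rest_gt0 : 0 < 1 - eps / e%:R by rewrite subr_gt0 ltr_pdivrMr // mul1r.
rewrite -[RHS]lnK ?posrE ?powR_gt0 ?mulr_gt0 ?powR_gt0 //.
rewrite ln_powR lnM ?posrE ?powR_gt0 // !ln_powR /peak_entropy; congr expR.
have -> : (1 - (1 + eps) / e.+1%:R) / e%:R = (1 - eps / e%:R) / e.+1%:R.
  by rewrite -natr1; field; rewrite natr1 !gt_eqF.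
rewrite !ln_div ?posrE // -[e.+1%:R]natr1; field.
by rewrite natr1 gt_eqF.
Qed.

End Entropy.

(** * Counting avoiders with a long increasing subsequence *)

Section UpperBound.
Variable R : realType.
Implicit Types (c K : R).

Lemma card_heavy_words (I J : finType) (q : J -> R) (A : {set {ffun I -> J}}) K :
  (forall i, 0 <= q i) -> \sum_i q i = 1 ->
  {in A, forall w : {ffun I -> J}, K <= \prod_t q (w t)} -> #|A|%:R * K <= 1.
Proof.
move=> q_ge0 q_sum heavy.
have total_weight : \sum_(w : {ffun I -> J}) \prod_t q (w t) = 1.
  by rewrite -(bigA_distr_bigA (fun _ i => q i)) big1.
rewrite -[leRHS]total_weight (bigID (mem A)) /= mulr_natl -sumr_const.
by apply: ler_wpDr; [apply: sumr_ge0 => w _; apply: prodr_ge0 | apply: ler_sum].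
Qed.

Lemma prod_peak_weight n e (q0 q1 : R) (w : {ffun 'I_n -> 'I_e.+1}) :
  \prod_t (if w t == ord0 then q0 else q1) = q0 ^+ zeros w * q1 ^+ (n - zeros w).
Proof.
rewrite (bigID (fun t => w t == ord0)) /=; congr (_ * _).
  rewrite (eq_bigr (fun=> q0)) => [|t ->//].
  by rewrite prodr_const /zeros cardsE.
rewrite (eq_bigr (fun=> q1)) => [|t /negPf->//].
rewrite prodr_const /zeros cardsE -[X in (X - _)%N]card_ord.
by rewrite -(cardC [pred t | w t == ord0]) addKn; congr (_ ^+ _); apply: eq_card.
Qed.

Lemma card_words_zeros_le n e c : (0 < e)%N -> e.+1%:R^-1 <= c < 1 ->
  #|[set w : {ffun 'I_n -> 'I_e.+1} | c * n%:R < (zeros w)%:R]|%:R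
    <= expR (n%:R * peak_entropy e c).
Proof.
move=> e0 /andP[c_ge c_lt]; have e_gt0 : 0 < e%:R :> R by rewrite ltr0n.
have d_gt0 : 0 < e.+1%:R :> R by rewrite ltr0n.
have c_gt0 : 0 < c by apply: lt_le_trans c_ge; rewrite invr_gt0.
pose q1 := (1 - c) / e%:R; have q1_gt0 : 0 < q1 by rewrite divr_gt0 // subr_gt0.
have q1_le : q1 <= c.
  by move: c_ge; rewrite ler_pdivrMr // -div1r ler_pdivrMr // -natr1; lra.
pose q (i : 'I_e.+1) := if i == ord0 then c else q1.
rewrite -[leRHS]invrK -expRN -[leRHS]mul1r ler_pdivlMr ?expR_gt0 //.
apply: (@card_heavy_words _ _ q) => [i||w]; first by rewrite /q; case: ifP => _; apply: ltW.
  rewrite (bigD1 ord0) //= (eq_bigr (fun=> q1)) => [|i /negPf i0]; last by rewrite /q i0.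
  by rewrite sumr_const cardC1 card_ord /q eqxx /q1 -mulr_natl; field; rewrite gt_eqF.
rewrite inE prod_peak_weight => cw.
have zeros_le : (zeros w <= n)%N by rewrite -[leqRHS]card_ord max_card.
rewrite -[c in X in _ <= X]lnK ?posrE // -[q1]lnK ?posrE // -!expRM_natl -expRD ler_expR.
rewrite natrB // /peak_entropy -/q1.
have : 0 <= ((zeros w)%:R - c * n%:R) * (ln c - ln q1); last by rewrite -subr_ge0; lra.
by rewrite mulr_ge0 ?subr_ge0 ?(ltW cw) // ler_ln ?posrE.
Qed.

Definition large_LIS e n c : {set 'S_n} :=
  [set s in avoiders n (decreasing_perm e.+2) | c * n%:R < (LIS s)%:R].

Lemma card_large_LIS_le_avoiders e n c :
  #|large_LIS e n c|%:R <= #|avoiders n (decreasing_perm e.+2)|%:R :> R.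
Proof.
by rewrite ler_nat subset_leq_card //; apply/subsetP => s; rewrite inE => /andP[].
Qed.

Lemma card_avoiders_le e n :
  #|avoiders n (decreasing_perm e.+2)|%:R <= expR (n%:R * (2 * ln e.+1%:R)) :> R.
Proof.
have := @card_avoiders_LIS n e xpredT (fun _ _ _ => isT).
rewrite (_ : finset _ = avoiders n (decreasing_perm e.+2)); last first.
  by apply/setP => s; rewrite inE andbT.
rewrite (_ : finset _ = setT); last by apply/setP => w; rewrite !inE.
rewrite cardsT card_ffun !card_ord -expnM -(ler_nat R) => /le_trans; apply.
by rewrite natrX mulrA -natrM expRM_natl lnK // posrE ltr0n.
Qed.

Lemma card_large_LIS_le e n c : (0 < e)%N -> e.+1%:R^-1 <= c < 1 ->
  #|large_LIS e n c|%:R <= expR (n%:R * (2 * peak_entropy e c)).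
Proof.
move=> e0 c_itv.
have c_up : {homo (fun a => c * n%:R < a%:R) : a b / (a <= b)%N >-> a ==> b}.
  by move=> a b ab; apply/implyP => /lt_le_trans; apply; rewrite ler_nat.
have := card_avoiders_LIS n e c_up; rewrite -(ler_nat R) => /le_trans; apply.
rewrite natrX mulrCA (expRM_natl 2).
by rewrite ler_pXn2r ?nnegrE ?expR_ge0 //; apply: card_words_zeros_le.
Qed.

End UpperBound.

Section LowerBound.
Variable R : realType.
Implicit Types (c eta : R).

Definition peak_content (e p m : nat) : seq 'I_e.+1 :=
  content_seq (fun i => if i == ord0 then p else m).

Lemma sum_peak e p m (T : nmodType) (F : nat -> T) :
  \sum_(i < e.+1) F (if i == ord0 then p else m) = F p + F m *+ e.
Proof.
rewrite (bigD1 ord0) //= (eq_bigr (fun=> F m)) => [|i /negPf->//].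
by rewrite sumr_const cardC1 card_ord.
Qed.

Lemma sum_peak_content e p m :
  (\sum_(i < e.+1) (if i == ord0 then p else m) = p + e * m)%N.
Proof. by apply: etrans (@sum_peak e p m nat id) _; rewrite -mulr_natl !ssralg.natrE. Qed.

Lemma size_peak_content e p m : size (peak_content e p m) = (p + e * m)%N.
Proof.
rewrite -sum_count_mem -(sum_peak_content e).
by apply: eq_bigr => i _; rewrite count_content_seq.
Qed.

Lemma ln_permutations_peak_ge e p m : (0 < e)%N -> (0 < p)%N -> (0 < m)%N ->
  (p + e * m)%:R * peak_entropy e (p%:R / (p + e * m)%:R)
    - e.+1%:R * (ln (p + e * m)%:R + 1)
  <= ln (size (permutations (peak_content e p m)))%:R :> R.
Proof.
move=> e0 p0 m0; set b := (p + e * m)%N.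
have b_gt0 : 0 < b%:R :> R by rewrite ltr0n addn_gt0 p0.
have e_gt0 : 0 < e%:R :> R by rewrite ltr0n.
have [p_gt0 m_gt0] : 0 < p%:R :> R /\ 0 < m%:R :> R by rewrite !ltr0n.
have bE : b%:R = p%:R + e%:R * m%:R :> R by rewrite natrD natrM.
apply: le_trans (ln_multinomial_ge _ _).
under eq_bigr => i _ do rewrite count_content_seq.
rewrite (sum_peak _ _ _ (fun a => a%:R * ln a%:R)) size_peak_content card_ord lerD2r.
rewrite /peak_entropy.
have -> : (1 - p%:R / b%:R) / e%:R = m%:R / b%:R :> R.
  by rewrite bE; field; rewrite -bE !gt_eqF.
rewrite !ln_div ?posrE // le_eqVlt; apply/orP; left; apply/eqP.
by rewrite -mulr_natl bE; field; rewrite -bE gt_eqF.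
Qed.

Lemma peak_entropy_continuous e c : (0 < e)%N -> 0 < c < 1 ->
  {for c, continuous (@peak_entropy R e)}.
Proof.
move=> e0 /andP[c_gt0 c_lt1]; have e_gt0 : 0 < e%:R :> R by rewrite ltr0n.
have cvg_rest : (1 - x @[x --> c] --> 1 - c)%classic.
  by apply: cvgB; [apply: cvg_cst | apply: cvg_id].
apply: cvgN; apply: cvgD; apply: cvgM => //; first exact: continuous_ln.
apply: continuous_cvg; last by apply: cvgMl.
by apply: continuous_ln; rewrite divr_gt0 // subr_gt0.
Qed.

Definition peak_count (e : nat) c (m : nat) : nat :=
  (Num.truncn (c * e%:R / (1 - c) * m%:R)).+1.

Lemma peak_count_itv e c m : 0 < c < 1 ->
  c * (peak_count e c m + e * m)%:R < (peak_count e c m)%:R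
    <= c * (peak_count e c m + e * m)%:R + 1.
Proof.
set p := peak_count e c m => /andP[c_gt0 c_lt1].
have c'_gt0 : 0 < 1 - c by rewrite subr_gt0.
have ratio_ge0 : 0 <= c * e%:R / (1 - c) * m%:R by rewrite !mulr_ge0 ?invr_ge0 // ltW.
have /andP[] := truncn_itv ratio_ge0; rewrite -[_.+1]/p natrD natrM.
rewrite -(lerD2r 1) natr1 -[_.+1]/p -(ltr_pM2l c'_gt0) -(ler_pM2l c'_gt0).
rewrite mulrDr mulrA (mulrC (1 - c) (_ / _)) divfK ?gt_eqF // => p_le p_gt.
by apply/andP; split; lra.
Qed.

Lemma peak_count_cvg e c : (0 < e)%N -> 0 < c < 1 ->
  ((peak_count e c m)%:R / (peak_count e c m + e * m)%:R @[m --> \oo] --> c)%classic.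
Proof.
move=> e0 c_itv.
have upper_cvg : (c + m%:R^-1 @[m --> \oo] --> c)%classic.
  rewrite -[X in (_ --> X)%classic]addr0; apply: cvgD; first exact: cvg_cst.
  apply/gtr0_cvgV0; last exact: cvgr_idn.
  by exists 1%N => // m; rewrite ltr0n.
apply: (squeeze_cvgr _ (cvg_cst c) upper_cvg).
exists 1%N => // m /= m_gt0; have /andP[pc_gt pc_le] := peak_count_itv e m c_itv.
set b := (_ + e * m)%N in pc_gt pc_le *.
have m_le_b : (m <= b)%N by rewrite /b (leq_trans _ (leq_addl _ _)) // leq_pmull.
have b_gt0 : 0 < b%:R :> R by rewrite ltr0n (leq_trans m_gt0).
rewrite ler_pdivlMr // (ltW pc_gt) /= ler_pdivrMr //.
apply: (le_trans pc_le); rewrite mulrDl lerD2l ler_pdivlMl ?ltr0n //.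
by rewrite mulr1 ler_nat.
Qed.

Lemma exists_peak_block e c eta : (0 < e)%N -> 0 < c < 1 -> 0 < eta -> exists p m,
  [/\ (0 < p)%N, (0 < m)%N, c * (p + e * m)%:R < p%:R &
    (p + e * m)%:R * (peak_entropy e c - eta) <=
      ln (size (permutations (peak_content e p m)))%:R].
Proof.
move=> e0 c_itv eta_gt0; have eta2_gt0 : 0 < eta / 2 by rewrite divr_gt0.
have entropy_cvg : (peak_entropy e ((peak_count e c m)%:R / (peak_count e c m + e * m)%:R)
    @[m --> \oo] --> peak_entropy e c)%classic.
  by apply: continuous_cvg (peak_count_cvg e0 c_itv); apply: peak_entropy_continuous.
have [M _ ln_small] := @near_ln_le R e.+1%:R (eta / 2) (ltr0Sn _ _) eta2_gt0.
near \oo%classic => m.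
have m_gt0 : (0 < m)%N by near: m; apply: nbhs_infty_gt.
have /= Mb : (M <= peak_count e c m + e * m)%N.
  have Mm : (M <= m)%N by near: m; apply: nbhs_infty_ge.
  by rewrite (leq_trans Mm) // (leq_trans _ (leq_addl _ _)) // leq_pmull.
have entropy_near : peak_entropy e c - eta / 2 <=
    peak_entropy e ((peak_count e c m)%:R / (peak_count e c m + e * m)%:R).
  by near: m; apply: (cvgr_ge _ entropy_cvg); lra.
exists (peak_count e c m), m; split=> //; first by have /andP[] := peak_count_itv e m c_itv.
apply: le_trans (ln_permutations_peak_ge e0 _ m_gt0) => //.
have := ler_wpM2l (ler0n R (peak_count e c m + e * m)) entropy_near.
by have := ln_small _ Mb; lra.
Unshelve. all: by end_near. Qed.

Lemma colorable_sub_large_LIS e p b n c : (0 < n)%N -> c < 1 -> c * b%:R < p%:R ->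
  colorable e n (n %/ b * p + n %% b) \subset large_LIS e n c.
Proof.
move=> n_gt0 c_lt1 cb_lt; apply: subset_trans (colorable_avoider _ _ _) _.
apply/subsetP => s; rewrite !inE => /andP[-> LIS_ge] /=.
apply: lt_le_trans (_ : (n %/ b * p + n %% b)%:R <= _); last by rewrite ler_nat.
rewrite [X in c * X%:R](divn_eq n b) !natrD !natrM mulrDr mulrCA.
case: (posnP (n %/ b)) => [q0|q_gt0].
  have r_gt0 : (0 < n %% b)%N by move: n_gt0; rewrite {1}(divn_eq n b) q0.
  by rewrite q0 !mul0r !add0r gtr_pMl ?ltr0n.
by rewrite ltr_leD ?ltr_pM2l ?ltr0n // ler_piMl // ltW.
Qed.

Lemma card_large_LIS_ge e p m n c :
  (0 < p)%N -> (0 < m)%N -> (0 < n)%N -> c < 1 -> c * (p + e * m)%:R < p%:R ->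
  (size (permutations (peak_content e p m)) ^ (2 * (n %/ (p + e * m) - e))
    <= #|large_LIS e n c|)%N.
Proof.
move=> p_gt0 m_gt0 n_gt0 c_lt1 cb_lt.
apply: leq_trans (subset_leq_card (colorable_sub_large_LIS e n_gt0 c_lt1 cb_lt)).
have := @card_colorable_ge e (n %/ (p + e * m)) (fun i => if i == ord0 then p else m)
  (n %% (p + e * m)).
by rewrite sum_peak_content -divn_eq eqxx; apply=> i; case: ifP.
Qed.

Lemma natr_divn_ge (b n : nat) : (0 < b)%N -> n%:R / b%:R - 1 <= (n %/ b)%:R :> R.
Proof.
move=> b_gt0; rewrite lerBlDr ler_pdivrMr ?ltr0n // natr1 -natrM ler_nat.
by rewrite ltnW // ltn_ceil.
Qed.

Lemma near_card_large_LIS_ge e c eta : (0 < e)%N -> 0 < c < 1 -> 0 < eta ->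
  (\forall n \near \oo,
    expR (n%:R * (2 * peak_entropy e c - eta)) <= #|large_LIS e n c|%:R)%classic.
Proof.
move=> e0 c_itv eta_gt0; have eta4_gt0 : 0 < eta / 4 by rewrite divr_gt0.
have [p [m [p_gt0 m_gt0 cb_lt]]] := exists_peak_block e0 c_itv eta4_gt0.
set b := (p + e * m)%N; set N := size _ => entropy_le.
have b_gt0 : (0 < b)%N by rewrite addn_gt0 p_gt0.
have N_gt0 : (0 < N)%N by apply: size_permutations_gt0.
have lnN_ge0 : 0 <= ln N%:R :> R by rewrite ln_ge0 // ler1n.
near=> n.
have n_gt0 : (0 < n)%N by near: n; apply: nbhs_infty_gt.
have n_large : 4 * e.+1%:R * ln N%:R / eta <= n%:R by near: n; apply: nbhs_infty_ger.
have c_lt1 : c < 1 by case/andP: c_itv.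
apply: le_trans (_ : (N ^ (2 * (n %/ b - e)))%:R <= _); last first.
  by rewrite ler_nat card_large_LIS_ge.
rewrite natrX -[X in _ <= X ^+ _]lnK ?posrE ?ltr0n // -expRM_natl ler_expR natrM.
have blocks_ge : n%:R / b%:R - e.+1%:R <= (n %/ b - e)%:R :> R.
  apply: le_trans (_ : (n %/ b)%:R - e%:R <= _).
    by have := natr_divn_ge n b_gt0; rewrite -natr1; lra.
  by rewrite lerBlDr -natrD ler_nat addnC -leq_subLR.
have := ler_wpM2r lnN_ge0 blocks_ge.
have : n%:R * (peak_entropy e c - eta / 4) <= n%:R / b%:R * ln N%:R.
  by rewrite -mulrA ler_wpM2l // [leRHS]mulrC ler_pdivlMr ?ltr0n // mulrC.
by move: n_large; rewrite ler_pdivrMr //; lra.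
Unshelve. all: by end_near. Qed.

End LowerBound.

Local Open Scope classical_set_scope.
Local Open Scope ring_scope.

(** * Growth rates and limits *)

Section Limits.
Variable R : realType.
Implicit Types (c eps l h : R).

Lemma ln_growth_cvg (a : R ^nat) h : (forall n, a n <= expR (n%:R * h)) ->
  (forall eta, 0 < eta -> \forall n \near \oo, expR (n%:R * (h - eta)) <= a n) ->
  ln (a n) / n%:R @[n --> \oo] --> h.
Proof.
move=> a_le a_ge; apply/cvgrPdist_le => eta eta_gt0; near=> n.
have n_gt0 : 0 < n%:R :> R by rewrite ltr0n; near: n; apply: nbhs_infty_gt.
have lower : expR (n%:R * (h - eta)) <= a n by near: n; apply: a_ge.
have a_gt0 : 0 < a n := lt_le_trans (expR_gt0 _) lower.
move: lower (a_le n); rewrite -{1 2}[a n]lnK // !ler_expR => lower upper.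
have ln_le : ln (a n) / n%:R <= h by rewrite ler_pdivrMr // mulrC.
by rewrite ger0_norm ?subr_ge0 // lerBlDl -lerBlDr ler_pdivlMr // mulrC.
Unshelve. all: by end_near. Qed.

Lemma powR_inv_cvg (a : R ^nat) h : (\forall n \near \oo, 0 < a n) ->
  ln (a n) / n%:R @[n --> \oo] --> h -> a n `^ n%:R^-1 @[n --> \oo] --> expR h.
Proof.
move=> a_gt0 ln_cvg.
apply: cvg_trans (continuous_cvg _ (@continuous_expR R h) ln_cvg).
apply: near_eq_cvg; apply: filterS a_gt0 => n an_gt0.
by rewrite /powR gt_eqF // mulrC.
Qed.

Lemma cvg0_of_powR_inv_cvg (a : R ^nat) l : (forall n, 0 <= a n) -> l < 1 ->
  a n `^ n%:R^-1 @[n --> \oo] --> l -> a n @[n --> \oo] --> 0.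
Proof.
move=> a_ge0 l_lt1 root_cvg.
have l_ge0 : 0 <= l by apply: cvgr_to_ge root_cvg _; apply: nearW => n; apply: powR_ge0.
pose r := (l + 1) / 2.
have [r_ge0 r_lt1] : 0 <= r /\ r < 1 by rewrite /r; split; lra.
apply: (squeeze_cvgr _ (cvg_cst 0) (cvg_expr (_ : `|r| < 1))); last first.
  by rewrite ger0_norm.
near=> n; rewrite a_ge0 /=.
have n_gt0 : n%:R != 0 :> R by rewrite pnatr_eq0 -lt0n; near: n; apply: nbhs_infty_gt.
have root_le : a n `^ n%:R^-1 <= r.
  by near: n; apply: (cvgr_le _ root_cvg); rewrite /r; lra.
rewrite -[a n]powRr1 // -(mulVf n_gt0) powRrM powR_mulrn ?powR_ge0 //.
by rewrite lerXn2r ?nnegrE ?powR_ge0.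
Unshelve. all: by end_near. Qed.

Lemma uniform_prob_eq0 (T : finType) (A : {set T}) (E : pred T) :
  {in A, forall x, ~~ E x} -> uniform_prob R A E = 0.
Proof.
move=> notE; rewrite /uniform_prob (_ : finset _ = finset.set0) ?cards0 ?mul0r //.
by apply/setP => x; rewrite !inE; apply/negbTE/negP => /andP[/notE/negPf->].
Qed.

Lemma uniform_prob_ge0 (T : finType) (A : {set T}) (E : pred T) : 0 <= uniform_prob R A E.
Proof. exact: divr_ge0. Qed.

Lemma uniform_prob_le (T : finType) (A : {set T}) (E F : pred T) :
  {in A, subpred E F} -> uniform_prob R A E <= uniform_prob R A F.
Proof.
move=> EF; rewrite ler_wpM2r ?invr_ge0 // ler_nat subset_leq_card //.
by apply/subsetP => x; rewrite !inE => /andP[xA /(EF x xA) ->]; rewrite xA.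
Qed.

Lemma ln_card_large_LIS_cvg e c : (0 < e)%N -> e.+1%:R^-1 <= c < 1 ->
  ln #|large_LIS e n c|%:R / n%:R @[n --> \oo] --> 2 * peak_entropy e c.
Proof.
move=> e0 c_itv; apply: ln_growth_cvg => [n|eta eta_gt0]; first exact: card_large_LIS_le.
by apply: near_card_large_LIS_ge => //; apply: frequency_gt0_lt1 c_itv.
Qed.

Lemma ln_card_avoiders_cvg e : (0 < e)%N ->
  ln #|avoiders n (decreasing_perm e.+2)|%:R / n%:R @[n --> \oo] --> (2 * ln e.+1%:R : R).
Proof.
move=> e0; apply: ln_growth_cvg => [n|eta eta_gt0]; first exact: card_avoiders_le.
have d_itv : 0 < (e.+1%:R^-1 : R) < 1.
  by rewrite invr_gt0 ltr0Sn invf_lt1 ?ltr0Sn // ltr1n ltnS.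
apply: filterS (near_card_large_LIS_ge e0 d_itv eta_gt0) => n.
by rewrite peak_entropy_uniform // => /le_trans; apply; apply: card_large_LIS_le_avoiders.
Qed.

Lemma avoid_prob_LIS_root_cvg e c : (0 < e)%N -> e.+1%:R^-1 <= c < 1 ->
  avoid_prob R (decreasing_perm e.+2) n (fun s => c * n%:R < (LIS s)%:R) `^ n%:R^-1
    @[n --> \oo] --> expR (2 * (peak_entropy e c - ln e.+1%:R)).
Proof.
move=> e0 c_itv; have c01 := frequency_gt0_lt1 c_itv.
have large_gt0 : \forall n \near \oo, 0 < #|large_LIS e n c|%:R :> R.
  apply: filterS (near_card_large_LIS_ge e0 c01 ltr01) => n; apply: lt_le_trans.
  exact: expR_gt0.
apply: powR_inv_cvg.
  apply: filterS large_gt0 => n an_gt0; apply: divr_gt0 => //.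
  exact: lt_le_trans (card_large_LIS_le_avoiders _ _ c).
rewrite mulrBr.
apply: cvg_trans (cvgB (ln_card_large_LIS_cvg e0 c_itv) (ln_card_avoiders_cvg e0)).
apply: near_eq_cvg; apply: filterS large_gt0 => n an_gt0.
rewrite -[LHS]mulrBl -ln_div // posrE.
exact: lt_le_trans (card_large_LIS_le_avoiders _ _ c).
Qed.

Lemma avoid_prob_LIS_lt e n :
  avoid_prob R (decreasing_perm e.+2) n (fun s => (LIS s)%:R < n%:R / e.+1%:R :> R) = 0.
Proof.
apply: uniform_prob_eq0 => s /avoider_LIS_ge n_le.
by rewrite -leNgt ler_pdivrMr ?ltr0n // -natrM ler_nat.
Qed.

Lemma avoid_prob_LIS_gt_cvg0 e eps : 0 < eps ->
  avoid_prob R (decreasing_perm e.+2) n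
    (fun s => (1 + eps) / e.+1%:R * n%:R < (LIS s)%:R) @[n --> \oo] --> (0 : R).
Proof.
move=> eps_gt0; have d_gt0 : 0 < e.+1%:R :> R by rewrite ltr0n.
case: (ltP eps e%:R) => [eps_lt|eps_ge].
  have e0 : (0 < e)%N by rewrite -(ltr0n R) (lt_trans eps_gt0).
  have c_itv := peak_frequency_itv eps_gt0 eps_lt; have /andP[c_gt c_lt] := c_itv.
  apply: cvg0_of_powR_inv_cvg (avoid_prob_LIS_root_cvg e0 _).
  - by move=> n; apply: uniform_prob_ge0.
  - by rewrite expR_lt1 pmulr_rlt0 // subr_lt0 peak_entropy_lt.
  - by rewrite c_lt ltW.
rewrite (_ : (fun n => _) = cst 0); first exact: cvg_cst.
apply/funext => n; apply: uniform_prob_eq0 => s _; rewrite -leNgt.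
apply: le_trans (_ : n%:R <= _); first by rewrite ler_nat LIS_le.
by rewrite ler_peMl // ler_pdivlMr // -natr1; lra.
Qed.

Lemma LIS_cvg_in_avoid_prob e :
  cvg_in_avoid_prob (decreasing_perm e.+2) (fun n s => (LIS s)%:R / n%:R) (1 / e.+1%:R : R).
Proof.
move=> delta delta_gt0; have d_gt0 : 0 < e.+1%:R :> R by rewrite ltr0n.
apply: (squeeze_cvgr _ (cvg_cst 0) (avoid_prob_LIS_gt_cvg0 e (mulr_gt0 delta_gt0 d_gt0))).
near=> n; have n_gt0 : 0 < n%:R :> R by rewrite ltr0n; near: n; apply: nbhs_infty_gt.
rewrite uniform_prob_ge0; apply: uniform_prob_le => s avoid_s /=.
have LIS_ge : 1 / e.+1%:R <= (LIS s)%:R / n%:R :> R.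
  rewrite ler_pdivrMr // mulrAC ler_pdivlMr // mul1r -natrM ler_nat.
  exact: avoider_LIS_ge avoid_s.
rewrite ger0_norm ?subr_ge0 // ltrBrDl ltr_pdivlMr //; congr (_ * _ < _).
by rewrite mulrDl mulfK ?gt_eqF.
Unshelve. all: by end_near. Qed.

End Limits.

Theorem theorem2p4 (R : realType) (k : nat) (hk : (2 <= k)%N) :
  let tau : 'S_k := decreasing_perm k in
  [/\ forall eps : R, 0 < eps -> eps < k%:R - 2 ->
        (avoid_prob R tau n
           (fun s => (1 + eps) / (k%:R - 1) * n%:R < (LIS s)%:R)) `^ (n%:R^-1)
          @[n --> \oo] -->
        (((1 + eps) `^ (1 + eps)
            * (1 - eps / (k%:R - 2)) `^ (k%:R - 2 - eps))
          `^ (- (2 / (k%:R - 1))) : R),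
      forall n : nat,
        avoid_prob R tau n (fun s => (LIS s)%:R < n%:R / (k%:R - 1) :> R) = 0
    & cvg_in_avoid_prob tau
        (fun (n : nat) (s : 'S_n) => (LIS s)%:R / n%:R : R) (1 / (k%:R - 1))].
Proof.
case: k hk => [|[|e]] // _; cbv zeta.
have -> : e.+2%:R - 2 = e%:R :> R by rewrite -[e.+2%:R]natr1 -[e.+1%:R]natr1; ring.
have -> : e.+2%:R - 1 = e.+1%:R :> R by rewrite -[e.+2%:R]natr1; ring.
split; last 2 first.
- exact: avoid_prob_LIS_lt.
- exact: LIS_cvg_in_avoid_prob.
move=> eps eps_gt0 eps_lt.
have e0 : (0 < e)%N by rewrite -(ltr0n R) (lt_trans eps_gt0).
have /andP[c_gt c_lt] := peak_frequency_itv eps_gt0 eps_lt.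
rewrite -peak_entropy_rate //; apply: avoid_prob_LIS_root_cvg => //.
by rewrite c_lt ltW.
Qed.
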